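(* Let $m=x_1^{d_1}\cdots x_n^{d_n}$ be any minimal monomial generator of $I=(x_1,\dots,x_n)^d$ (so $d_1+\dots+d_n=d$). For each $i\in\{1,\dots,n\}$ let $X_i$ be the complex of boxes of the principal $Q_i$-Borel ideal $I_i=\mathrm{Borel}_{Q_i}(m)$. Then the complex $$X=\bigcup_{i=1}^n X_i$$ supports a minimal free resolution of $I$.
   Context: $k$ is a field, $S=k[x_1,\dots,x_n]$, $d\ge 1$. $G(B)$ denotes the minimal monomial generating set of a monomial ideal $B$. Indices of variables are read modulo $n$. Cyclic intervals: $[i,j]=\{i,i+1,\dots,j\}$ if $i\le j$, and $[i,j]=\{i,\dots,n,1,\dots,j\}$ if $i>j$ (so $[i,i-1]=\{1,\dots,n\}$). $Q_i$ is the total order $x_i<x_{i+1}<\dots<x_n<x_1<\dots<x_{i-1}$. A monomial ideal $B$ is $Q_i$-Borel if for every monomial $f\in B$, every $x_b$ dividing $f$ and every $x_a<_{Q_i}x_b$ one has $f x_a/x_b\in B$. $\mathrm{Borel}_{Q_i}(m)$ is the smallest $Q_i$-Borel ideal containing $m$. For a monomial $f=x_{j_1}\cdots x_{j_d}$ with $x_{j_1}\le_{Q_i}\dots\le_{Q_i}x_{j_d}$, the box $\Gamma_i(f)$ is the polytope $\Delta_{[i,j_1]}\times\Delta_{[j_1,j_2]}\times\dots\times\Delta_{[j_{d-1},j_d]}$, where $\Delta_{[a,b]}$ is the simplex with vertex set $\{x_c:c\in[a,b]\}$. A vertex of the box is a tuple of variables and is labelled by the product of these variables (distinct vertices have distinct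 labels); the box is realized in $\mathbb{R}^n$ as the convex hull of the exponent vectors of its vertex labels. If $B$ is a $Q_i$-Borel ideal generated in degree $d$, its complex of boxes is the polytopal complex consisting of all faces of the boxes $\Gamma_i(f)$, $f\in G(B)$. A polytopal complex $X$ with vertices labelled by monomials is a labelled complex, with $\ell(F)=\mathrm{lcm}\{\ell(v):v\in F\text{ a vertex}\}$ for each face $F$. It yields a complex of free $S$-modules with one basis element in homological degree $\dim F$ and multidegree $\ell(F)$ for each nonempty face $F$, and differential $\partial(F)=\sum_{G}\mathrm{sign}(G,F)\frac{\ell(F)}{\ell(G)}G$ over facets $G$ of $F$ (with the usual incidence signs). $X$ supports a (minimal) free resolution of a monomial ideal $M$ if its vertex labels generate $M$ and this complex is a (minimal) free resolution of $M$ (equivalently, of $S/M$ after adding the empty face). *)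

(* Defs.v *)
From HB Require Import structures.
From mathcomp Require Import all_boot all_order all_algebra finmap mpoly.

Set Implicit Arguments.
Unset Strict Implicit.
Unset Printing Implicit Defensive.

Import Order.TTheory GRing.Theory Num.Theory.

Local Open Scope fset_scope.
Local Open Scope ring_scope.

(* Ideals of k[x_1, ..., x_n] are represented by their membership predicates;
   the variables are indexed from 0, by 'I_n. *)
Section Ideals.
Variables (k : fieldType) (n : nat).
Local Notation S := {mpoly k[n]}.
Implicit Types (B : S -> Prop) (A : {fset 'X_{1..n}}).

Definition ideal_gen (P : S -> Prop) (p : S) : Prop :=
  exists s : seq (S * S),
    (forall q, q \in s -> P q.2) /\ p = \sum_(q <- s) q.1 * q.2.

Definition ideal_pow B (d : nat) : S -> Prop :=
  ideal_gen (fun p => exists t : d.-tuple S,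
    (forall j, B (tnth t j)) /\ p = \prod_j tnth t j).

Definition ideal_vars : S -> Prop := ideal_gen (fun p => exists j, p = 'X_j).

Definition mono_ideal (P : 'X_{1..n} -> Prop) : S -> Prop :=
  ideal_gen (fun p => exists2 f, P f & p = 'X_[f]).

Definition monomial_ideal B : Prop :=
  exists P, forall p, B p <-> mono_ideal P p.

Definition mono_generates A B : Prop :=
  forall p, B p <-> mono_ideal (fun f => f \in A) p.

(* [min_gen B f] : f \in G(B). *)
Definition min_gen B (f : 'X_{1..n}) : Prop :=
  exists A, [/\ mono_generates A B,
    forall A', A' `<=` A -> mono_generates A' B -> A' = A & f \in A].

End Ideals.

Arguments ideal_vars : clear implicits.

(* A polytope in R^p is given by the finite set F of its vertices, a vertex v
   sitting at the point [pos v]; a face of it is given by the vertices which it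
   contains. *)
Section Polytopes.
Variables (R : realFieldType) (p : nat) (V : choiceType) (pos : V -> 'rV[R]_p).
Implicit Types F G H : {fset V}.

Definition conv F (x : 'rV[R]_p) : Prop :=
  exists w : V -> R, [/\ forall v, v \in F -> 0 <= w v,
    \sum_(v <- F) w v = 1 & x = \sum_(v <- F) w v *: pos v].

Definition dotmul (c x : 'rV[R]_p) : R := (c *m x^T) 0 0.

(* The inequality c.x <= b is valid on F and cuts out the face G; both F itself
   and the empty face are faces of F. *)
Definition is_face G F : Prop :=
  exists (c : 'rV[R]_p) (b : R),
    (forall v, v \in F -> dotmul c (pos v) <= b) /\
    G = [fset v in F | dotmul c (pos v) == b].

Definition polytopal_complex (X : {fset {fset V}}) : Prop :=
  [/\ (* each element of F is a vertex of conv F *)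
      forall F v, F \in X -> v \in F -> ~ conv (F `\ v) (pos v),
      forall F G, F \in X -> is_face G F -> G \in X
    & forall F G, F \in X -> G \in X ->
        exists H, [/\ is_face H F, is_face H G
          & forall x, conv F x /\ conv G x <-> conv H x]].

(* The linear space parallel to the affine hull of F, as a row space. *)
Definition direction F : 'M[R]_p :=
  (\sum_(v <- F) \sum_(w <- F) <<pos v - pos w>>)%MS.

Definition dimf F : nat := \rank (direction F).

Definition barycenter F : 'rV[R]_p :=
  (#|` F|%:R)^-1 *: \sum_(v <- F) pos v.

(* The rows of [o i F] are an ordered basis of the direction of the
   i-dimensional face F; the values of o elsewhere are irrelevant. *)
Definition orientation (X : {fset {fset V}})
    (o : forall i, {fset V} -> 'M[R]_(i, p)) : Prop :=
  forall F, F \in X -> F != fset0 -> (o (dimf F) F :=: direction F)%MS.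

(* For a facet G of F with i = dim G: let A be the basis of [direction F]
   formed by an outward pointing vector and the basis o i G.  If A = P B with
   B = o i.+1 F, then \det (A B^T) = \det P * \det (B B^T) and the Gram
   determinant \det (B B^T) is positive, so the value is the sign of \det P. *)
Definition incidence (o : forall i, {fset V} -> 'M[R]_(i, p)) (i : nat) G F
    : int :=
  sgz (\det (col_mx (barycenter G - barycenter F) (o i G) *m (o i.+1 F)^T
             : 'M_i.+1)).

Definition cells (X : {fset {fset V}}) (i : nat) : {fset {fset V}} :=
  [fset F in X | (F != fset0) && (dimf F == i)].

End Polytopes.

(* Complexes ... -> S^(B 2) -> S^(B 1) -> S^(B 0) -> M -> 0 of free modules of
   finite rank, S = k[x_1, ..., x_n], where [delta i x y] is the coefficient of
   the basis element y in the image of the basis element x, and [eps x] is the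
   image of x in M. *)
Section Resolutions.
Variables (k : fieldType) (n : nat).
Local Notation S := {mpoly k[n]}.

Definition free_map (B C : finType) (D : B -> C -> S) (c : {ffun B -> S})
    : {ffun C -> S} :=
  [ffun y => \sum_x c x * D x y].

Definition augment (B : finType) (eps : B -> S) (c : {ffun B -> S}) : S :=
  \sum_x c x * eps x.

Variables (B : nat -> finType) (delta : forall i, B i.+1 -> B i -> S).
Variables (eps : B 0%N -> S) (M : S -> Prop).

Definition free_resolution : Prop :=
  [/\ forall q, M q <-> exists c, q = augment eps c,
      forall c, augment eps c = 0 <-> exists b, c = free_map (@delta 0%N) b
    & forall i c, free_map (@delta i) c = 0 <->
        exists b, c = free_map (@delta i.+1) b].

Definition minimal_free_resolution : Prop :=
  free_resolution /\
  forall i b (y : B i), ideal_vars k n (free_map (@delta i) b y).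

End Resolutions.

Section Labelled.
Variables (R : realFieldType) (p : nat) (V : choiceType) (pos : V -> 'rV[R]_p).
Variables (k : fieldType) (n : nat) (lab : V -> 'X_{1..n}).
Local Notation S := {mpoly k[n]}.

Definition face_label (F : {fset V}) : 'X_{1..n} :=
  \big[@mlcm n/0%MM]_(v <- F) lab v.

(* In a polytopal complex, a cell contained in another one is a face of it. *)
Definition cell_boundary (o : forall i, {fset V} -> 'M[R]_(i, p))
    (X : {fset {fset V}}) (i : nat)
    (F : cells pos X i.+1) (G : cells pos X i) : S :=
  if val G `<=` val F then
    (incidence pos o i (val G) (val F))%:~R *:
      'X_[face_label (val F) - face_label (val G)]
  else 0.

Definition cell_augment (X : {fset {fset V}}) (v : cells pos X 0) : S :=
  'X_[face_label (val v)].

(* X is the predicate defining the faces of the complex.  All orientations give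
   isomorphic complexes of free modules. *)
Definition supports_minimal_free_resolution
    (X : {fset V} -> Prop) (M : S -> Prop) : Prop :=
  exists2 C : {fset {fset V}}, forall F, F \in C <-> X F &
    [/\ polytopal_complex pos C,
        forall q, M q <-> mono_ideal
          (fun f => exists2 v, [fset v] \in C & f = lab v) q
      & forall o, orientation pos C o ->
          minimal_free_resolution (cell_boundary o (X := C))
            (@cell_augment C) M].

End Labelled.

Section Boxes.
Variable n : nat.
Implicit Types i a b c : 'I_n.

Definition Qle i a b : bool := ((a + n - i) %% n <= (b + n - i) %% n)%N.

Definition Qlt i a b : bool := ((a + n - i) %% n < (b + n - i) %% n)%N.

(* c \in [a, b] *)
Definition cyclic_interval a b c : bool :=
  if (a <= b)%N then (a <= c <= b)%N else ((a <= c) || (c <= b))%N.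

(* The word j_1 ... j_d with f = x_{j_1} ... x_{j_d}, increasing for Q_i. *)
Definition Qword i (f : 'X_{1..n}) : seq 'I_n :=
  sort (Qle i) (flatten [seq nseq (f j) j | j <- enum 'I_n]).

(* The tuple (x_{t_1}, ..., x_{t_d}) is a vertex of Gamma_i(f) when t_s is in
   [j_{s-1}, j_s] for all s, where j_0 = i. *)
Definition box_vertex i (f : 'X_{1..n}) (t : (mdeg f).-tuple 'I_n) : bool :=
  let w := Qword i f in
  all2 (fun ab c => cyclic_interval ab.1 ab.2 c) (zip (i :: w) w) t.

Arguments box_vertex : clear implicits.

(* Vertices are identified with their labels. *)
Definition box i (f : 'X_{1..n}) : {fset 'X_{1..n}} :=
  [fset (\sum_(c <- tval t) U_(c))%MM
    | t in [pred t : (mdeg f).-tuple 'I_n | box_vertex i f t]].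

Definition exponent_vector (R : realFieldType) (f : 'X_{1..n}) : 'rV[R]_n :=
  \row_j (f j)%:R.

Variable k : fieldType.
Local Notation S := {mpoly k[n]}.

Definition Q_Borel i (B : S -> Prop) : Prop :=
  monomial_ideal B /\
  forall (f : 'X_{1..n}) b a, B 'X_[f] -> (0 < f b)%N -> Qlt i a b ->
    B 'X_[f - U_(b) + U_(a)].

(* The intersection of all Q_i-Borel ideals which contain f. *)
Definition principal_Borel i (f : 'X_{1..n}) : S -> Prop :=
  fun q => forall B, Q_Borel i B -> B 'X_[f] -> B q.

Definition complex_of_boxes (R : realFieldType) i (B : S -> Prop)
    (F : {fset 'X_{1..n}}) : Prop :=
  exists2 f, min_gen B f & is_face (exponent_vector R) F (box i f).

End Boxes.

Arguments principal_Borel {n} k i f _.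

(* Main.v *)
Require Import Defs.
From mathcomp Require Import all_boot all_order all_algebra finmap mpoly.
From mathcomp Require Import ring lra zify.

(** For a monomial u of degree d, compare the partial sums of its exponents with
    those of m, going around the circle of the n variables.  The differences are
    defined up to an additive constant; [profile] normalizes them to a function
    K_u with values in the natural numbers and minimum 0, that is, to a lattice
    point on the boundary of the positive orthant.  In these coordinates
    everything becomes simple: the generators of the ideal Borel_{Q_i}(m) are the
    monomials with K_u(i) = 0 ([min_gen_principal_Borel]), and the box of f
    consists of the u with K_u(i) = 0 and K_f <= K_u <= K_f + 1
    ([mem_box_profile]).  So X is the cubical grid on the boundary of the orthant,
    cut by the inequalities which say that exponents are nonnegative.

    A nonempty cell F of X has a vertex v with the largest profile, and F is
    determined by v and a set sg of variables x_c with K_v(c) > 0; every such pair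
    occurs.  The label of F is the product of v and the variables in sg, and its
    dimension is the number of elements of sg.  These are the cells [cell v sg];
    their faces are cells again ([cell_face]), the boxes are cells ([box_is_cell])
    and each cell lies in a box ([cell_in_box]).

    The sum of the squares of the values of K_u is a convex function of u, and
    each cell is the set of vertices at which one affine function touches it from
    below ([cell_lower_face]).  So X is a regular subdivision, in particular a
    polytopal complex ([regular_complex]).  The incidence numbers of any polytopal
    complex are nonzero on facets ([cell_incidence_neq0]) and define a complex
    ([incidence_sum]).  As a cell of dimension i has a label of degree d + i, the
    resolution is minimal as soon as it is one.

    For exactness, filter the free modules by the weight of the top vertex v, the
    sum of the values of K_v.  The facets of (v, sg) are the (v, sg minus c) and
    cells with lighter tops, so the layer of v is a Koszul complex on the x_c with
    K_v(c) > 0.  In multidegree b it is exact unless v_c = b_c for all these c.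
    There is only one such v dividing x^b: read backwards around the circle, K_v is
    the length of a queue with arrivals m_c, and v serves at the full capacity b_c
    whenever the queue is not empty, which determines the queue
    ([saturated_uniq]).  So one generator survives in each multidegree of the
    ideal, and the complex is a resolution ([koszul_filtration_resolution]). *)

Set Implicit Arguments.
Unset Strict Implicit.
Unset Printing Implicit Defensive.
Import Order.TTheory GRing.Theory Num.Theory.
Local Open Scope fset_scope.
Local Open Scope ring_scope.

(** * Gram determinants and signs *)

Section Gram.
Variables (R : realFieldType) (p : nat).

Lemma dotmulE (c x : 'rV[R]_p) : dotmul c x = \sum_j c 0 j * x 0 j.
Proof. by rewrite /dotmul mxE; apply: eq_bigr => j _; rewrite mxE. Qed.

Lemma dotmulBr (c x y : 'rV[R]_p) : dotmul c (x - y) = dotmul c x - dotmul c y.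
Proof. by rewrite /dotmul linearB /= mulmxBr !mxE. Qed.

Lemma dotmulDr (c x y : 'rV[R]_p) : dotmul c (x + y) = dotmul c x + dotmul c y.
Proof. by rewrite /dotmul linearD /= mulmxDr !mxE. Qed.

Lemma dotmulZr a (c x : 'rV[R]_p) : dotmul c (a *: x) = a * dotmul c x.
Proof. by rewrite /dotmul linearZ /= -scalemxAr !mxE. Qed.

Lemma dotmulDl (c c' x : 'rV[R]_p) : dotmul (c + c') x = dotmul c x + dotmul c' x.
Proof. by rewrite /dotmul mulmxDl !mxE. Qed.

Lemma dotmulZl a (c x : 'rV[R]_p) : dotmul (a *: c) x = a * dotmul c x.
Proof. by rewrite /dotmul -scalemxAl !mxE. Qed.

Lemma dotmulBl (c c' x : 'rV[R]_p) : dotmul (c - c') x = dotmul c x - dotmul c' x.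
Proof. by rewrite /dotmul mulmxBl !mxE. Qed.

Lemma dotmul_sumr (I : Type) (r : seq I) (c : 'rV[R]_p) (f : I -> 'rV[R]_p) :
  dotmul c (\sum_(v <- r) f v) = \sum_(v <- r) dotmul c (f v).
Proof.
elim/big_rec2: _ => [|i y x _ <-]; last by rewrite dotmulDr.
by rewrite /dotmul linear0 mulmx0 mxE.
Qed.

Lemma dotmul_eq0P (c x : 'rV[R]_p) : (dotmul c x == 0) = (x <= kermx c^T)%MS.
Proof.
have -> : dotmul c x = (x *m c^T) 0 0.
  by rewrite dotmulE !mxE; apply: eq_bigr => j _; rewrite mxE mulrC.
apply/eqP/sub_kermxP => [h|->]; last by rewrite mxE.
by apply/matrixP => i j; rewrite !ord1 h mxE.
Qed.

Lemma dotmul_gt0 (x : 'rV[R]_p) : x != 0 -> 0 < dotmul x x.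
Proof.
move=> x0; rewrite dotmulE lt_neqAle sumr_ge0 => [|j _]; last exact: sqr_ge0.
rewrite andbT eq_sym; apply: contraNneq x0 => h.
apply/eqP/matrixP => i j; rewrite ord1 mxE.
have /allP/(_ j) := etrans (esym (psumr_eq0 _ (fun i _ => sqr_ge0 (x 0 i)))) (introT eqP h).
by rewrite mem_index_enum => /(_ isT) /=; rewrite sqrf_eq0 => /eqP.
Qed.

(** Induction on the number of rows: subtracting from the first row its
    orthogonal projection onto the others makes the Gram matrix block diagonal
    without changing its determinant. *)
Lemma gram_det_gt0 q (B : 'M[R]_(q, p)) : row_free B -> 0 < \det (B *m B^T).
Proof.
elim: q B => [|q IH] B fB; first by rewrite det_mx00 ltr01.
move: fB; rewrite -[B](@vsubmxK _ 1 q p); set b := usubmx _; set B' := dsubmx _.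
move=> fB.
have fB' : row_free B'.
  rewrite /row_free eqn_leq rank_leq_row /= -(leq_add2l 1).
  have : (1 + q <= \rank (col_mx b B'))%N by rewrite (eqP fB).
  rewrite -addsmxE => /leq_trans; apply.
  by rewrite (leq_trans (mxrank_adds_leqif _ _)) // leq_add2r rank_leq_row.
have g := IH _ fB'.
have uG : B' *m B'^T \in unitmx by rewrite unitmxE unitfE gt_eqF.
pose y := b *m B'^T *m invmx (B' *m B'^T).
pose b1 := b - y *m B'.
have b1B : b1 *m B'^T = 0.
  by rewrite mulmxBl -mulmxA /y mulmxKV // subrr.
have b10 : b1 != 0.
  apply: contraTneq fB => /eqP; rewrite subr_eq0 => /eqP h.
  have : (\rank (col_mx b B') <= q)%N.
    rewrite -addsmxE; apply: leq_trans (mxrankS _) (rank_leq_row B').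
    by rewrite addsmx_sub submx_refl andbT h submxMl.
  by rewrite -ltnS /row_free neq_ltn => ->.
have E : col_mx b B' = block_mx 1%:M y 0 1%:M *m col_mx b1 B'.
  by rewrite mul_block_col !mul1mx mul0mx add0r /b1 subrK.
rewrite E trmx_mul -mulmxA !det_mulmx mulmxA det_mulmx det_tr.
rewrite (det_ublock (1%:M : 'M[R]_1) y 1%:M) !det1 !mul1r mulr1.
rewrite tr_col_mx mul_col_row b1B.
have -> : B' *m b1^T = 0 by rewrite -[B']trmxK -trmx_mul b1B trmx0.
rewrite (det_ublock (b1 *m b1^T) 0 (B' *m B'^T)) mulr_gt0 // det_mx11.
exact: dotmul_gt0.
Qed.

(** The incidence numbers are signs of such determinants; as Gram determinants
    are positive, they are signs of matrices of change of basis. *)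
Lemma sgz_det_gram q (A B : 'M[R]_(q, p)) (P : 'M[R]_q) :
  row_free B -> A = P *m B -> sgz (\det (A *m B^T)) = sgz (\det P).
Proof.
move=> fB ->; rewrite -mulmxA det_mulmx sgzM (gtr0_sgz (gram_det_gt0 fB)).
by rewrite mulr1.
Qed.

End Gram.

Section Signs.
Variables (R : realFieldType) (p : nat).

Lemma det_col_mx_linear q (N : 'M[R]_(q, p)) (K : 'M[R]_(p, q.+1)) a b (x y : 'rV[R]_p) :
  \det (col_mx (a *: x + b *: y) N *m K : 'M_q.+1)
  = a * \det (col_mx x N *m K : 'M_q.+1) + b * \det (col_mx y N *m K : 'M_q.+1).
Proof.
apply: (@determinant_multilinear _ q.+1 _ _ _ ord0).
- have E (z : 'rV[R]_p) : row ord0 (col_mx z N *m K : 'M_q.+1) = z *m K.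
    rewrite row_mul; congr (_ *m K); apply/rowP => j; rewrite mxE.
    by rewrite -(col_mxEu z N); congr (col_mx _ _ _ _); apply: val_inj.
  by rewrite !E mulmxDl !scalemxAl.
- rewrite !row'Esub; apply/matrixP => i j; rewrite !mxE; apply: eq_bigr => l _.
  have E (z : 'rV[R]_p) : col_mx z N (lift ord0 i) l = N i l.
    by rewrite -(col_mxEd z N); congr (col_mx _ _ _ _); apply: val_inj.
  by rewrite !E.
- rewrite !row'Esub; apply/matrixP => i j; rewrite !mxE; apply: eq_bigr => l _.
  have E (z : 'rV[R]_p) : col_mx z N (lift ord0 i) l = N i l.
    by rewrite -(col_mxEd z N); congr (col_mx _ _ _ _); apply: val_inj.
  by rewrite !E.
Qed.

Lemma det_col_mx_sub q (N : 'M[R]_(q, p)) (K : 'M[R]_(p, q.+1)) (x : 'rV[R]_p) :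
  (x <= N)%MS -> \det (col_mx x N *m K : 'M_q.+1) = 0.
Proof.
move=> xN; apply/eqP; rewrite -[_ == 0]negbK -unitfE -unitmxE -row_free_unit.
rewrite /row_free neq_ltn; apply/orP; left; rewrite ltnS.
have rN : (\rank (col_mx x N) <= q)%N.
  rewrite -addsmxE; apply: leq_trans (mxrankS _) (rank_leq_row N).
  by rewrite addsmx_sub xN submx_refl.
exact: leq_trans (mxrankM_maxl _ _) rN.
Qed.

(** The product of two incidence numbers, H in G and G in F, is the sign of one
    determinant.  Here g and h are the barycenters of G and H relative to that
    of F, the rows of O, H and K are the chosen bases of G, H and F; the outward
    vector h - g of H in G may be replaced by h, because g is already a row. *)
Lemma sgz_det_step i (K : 'M[R]_(i.+2, p)) (O : 'M[R]_(i.+1, p))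
    (H : 'M[R]_(i, p)) (g h : 'rV[R]_p) :
  row_free O -> (col_mx (h - g) H <= O)%MS ->
  sgz (\det (col_mx (h - g) H *m O^T : 'M_i.+1))
    * sgz (\det (col_mx g O *m K^T : 'M_i.+2))
  = sgz (\det (col_mx g (col_mx h H : 'M_(i.+1, p)) *m K^T : 'M_i.+2)).
Proof.
move=> fO /submxP[P eP].
have -> : sgz (\det (col_mx (h - g) H *m O^T : 'M_i.+1)) = sgz (\det (P : 'M_i.+1)).
  exact: sgz_det_gram.
have -> : col_mx g (col_mx h H : 'M_(i.+1, p))
        = block_mx 1%:M 0 (col_mx 1%:M 0 : 'M_(1 + i, 1)) P *m col_mx g O.
  rewrite mul_block_col mul0mx addr0 mul1mx -eP mul_col_mx mul1mx mul0mx.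
  by rewrite add_col_mx add0r addrC subrK.
rewrite -mulmxA det_mulmx (det_lblock (1%:M : 'M[R]_1)) det1 mul1r.
by rewrite sgzM.
Qed.

End Signs.

(** * Directions and dimensions of faces *)

Section Direction.
Variables (R : realFieldType) (p : nat) (V : choiceType) (pos : V -> 'rV[R]_p).
Implicit Types F G H : {fset V}.
Local Notation direction := (direction pos).
Local Notation dimf := (dimf pos).
Local Notation barycenter := (barycenter pos).

Lemma direction_sub q (U : 'M[R]_(q, p)) F :
  (forall v w, v \in F -> w \in F -> (pos v - pos w <= U)%MS) ->
  (direction F <= U)%MS.
Proof.
move=> h; rewrite /Defs.direction big_seq.
apply: (big_ind (fun A : 'M[R]_p => (A <= U)%MS)) => [|A B hA hB|v hv].
- exact: sub0mx.
- by rewrite addsmx_sub hA.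
rewrite big_seq; apply: (big_ind (fun A : 'M[R]_p => (A <= U)%MS)) => [|A B hA hB|w hw].
- exact: sub0mx.
- by rewrite addsmx_sub hA.
by rewrite genmxE h.
Qed.

Lemma direction_diff F v w :
  v \in F -> w \in F -> (pos v - pos w <= direction F)%MS.
Proof.
move=> hv hw; rewrite /Defs.direction (big_rem v) //=.
apply: submx_trans (addsmxSl _ _); rewrite (big_rem w) //=.
by apply: submx_trans (addsmxSl _ _); rewrite genmxE.
Qed.

Lemma direction_mono F G : F `<=` G -> (direction F <= direction G)%MS.
Proof.
move=> FG; apply: direction_sub => v w hv hw.
by apply: direction_diff; apply: (fsubsetP FG).
Qed.

Lemma direction_dot F c b x :
  (forall v, v \in F -> dotmul c (pos v) = b) ->
  (x <= direction F)%MS -> dotmul c x = 0.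
Proof.
move=> h xF; apply/eqP; rewrite dotmul_eq0P; apply: submx_trans xF _.
apply: direction_sub => v w hv hw.
by rewrite -dotmul_eq0P dotmulBr !h // subrr.
Qed.

Lemma barycenter_sub F G w : G `<=` F -> G != fset0 -> w \in F ->
  (barycenter G - pos w <= direction F)%MS.
Proof.
move=> GF G0 hw.
have N0 : (#|` G|%:R : R) != 0 by rewrite pnatr_eq0 cardfs_eq0.
have -> : barycenter G - pos w = (#|` G|%:R)^-1 *: \sum_(v <- G) (pos v - pos w).
  rewrite sumrB scalerBr; congr (_ - _).
  by rewrite big_const_seq count_predT iter_addr_0 -scaler_nat scalerA mulVf ?scale1r.
rewrite scalemx_sub // big_seq; apply: summx_sub => v hv.
by apply: direction_diff => //; apply: (fsubsetP GF).
Qed.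

Lemma barycenter_diff F G H : G `<=` F -> G != fset0 -> H `<=` F -> H != fset0 ->
  (barycenter G - barycenter H <= direction F)%MS.
Proof.
move=> GF G0 HF H0; have [w hw] := fset0Pn _ G0.
have wF := fsubsetP GF _ hw.
rewrite -[barycenter G](subrK (pos w)) -addrA addmx_sub ?barycenter_sub //.
by rewrite -opprB eqmx_opp barycenter_sub.
Qed.

Lemma barycenter_eq F c b : F != fset0 ->
  (forall v, v \in F -> dotmul c (pos v) = b) -> dotmul c (barycenter F) = b.
Proof.
move=> F0 h; rewrite dotmulZr dotmul_sumr big_seq (eq_bigr (fun _ => b)) //.
rewrite -big_seq big_const_seq count_predT iter_addr_0 -[b *+ _]mulr_natl mulKf //.
by rewrite pnatr_eq0 cardfs_eq0.
Qed.

Lemma barycenter_lt F c b : (forall v, v \in F -> dotmul c (pos v) <= b) ->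
  (exists2 v, v \in F & dotmul c (pos v) != b) -> dotmul c (barycenter F) < b.
Proof.
move=> h [w hw wb].
have N0 : 0 < (#|` F|%:R : R) by rewrite ltr0n cardfs_gt0; apply/fset0Pn; exists w.
rewrite dotmulZr dotmul_sumr mulrC ltr_pdivrMr //.
have -> : b * #|` F|%:R = \sum_(v <- F) b.
  by rewrite big_const_seq count_predT iter_addr_0 mulr_natr.
rewrite (big_rem w) //= [ltRHS](big_rem w) //= ltr_leD //.
  by rewrite lt_neqAle wb h.
rewrite big_seq [leRHS]big_seq; apply: ler_sum => v /mem_rem; exact: h.
Qed.

Lemma dimf_lt F G c b : G `<=` F -> G != fset0 ->
  (forall v, v \in G -> dotmul c (pos v) = b) ->
  (exists2 v, v \in F & dotmul c (pos v) != b) -> (dimf G < dimf F)%N.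
Proof.
move=> GF /fset0Pn[w hw] h [v hv vb]; apply: rank_ltmx.
rewrite /ltmx direction_mono //=; apply: contra vb => sub.
have /direction_dot : (pos v - pos w <= direction G)%MS.
  apply: submx_trans sub; apply: direction_diff => //.
  exact: (fsubsetP GF).
by move=> /(_ _ _ h)/eqP; rewrite dotmulBr subr_eq0 (h w) // => /eqP ->.
Qed.

(** By dimension: on the direction of F, the hyperplane c = 0 contains the
    direction of its facet G and is not everything. *)
Lemma direction_facet F G c b x : G `<=` F -> G != fset0 ->
  dimf F = (dimf G).+1 ->
  (forall v, v \in G -> dotmul c (pos v) = b) ->
  (exists2 v, v \in F & dotmul c (pos v) != b) ->
  (x <= direction F)%MS -> dotmul c x = 0 -> (x <= direction G)%MS.
Proof.
move=> GF G0 dF h ex xF /eqP; rewrite dotmul_eq0P => xc.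
have sub1 : (direction G <= direction F :&: kermx c^T)%MS.
  rewrite sub_capmx direction_mono //; apply: direction_sub => v w hv hw.
  by rewrite -dotmul_eq0P dotmulBr !h // subrr.
have [v hv vb] := ex; have [w hw] := fset0Pn _ G0.
have : (\rank (direction F :&: kermx c^T)%MS < dimf F)%N.
  apply: rank_ltmx; rewrite /ltmx capmxSl /=; apply: contra vb => sub.
  have : (pos v - pos w <= direction F :&: kermx c^T)%MS.
    by apply: submx_trans sub; rewrite direction_diff // (fsubsetP GF).
  rewrite sub_capmx -dotmul_eq0P dotmulBr subr_eq0 => /andP[_ /eqP ->].
  by rewrite h.
rewrite dF ltnS => le1.
have /eqP e : \rank (direction G) == \rank (direction F :&: kermx c^T)%MS.
  by rewrite eqn_leq mxrankS.
move/eqP: e; rewrite (eq_leqif (mxrank_leqif_eq sub1)).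
move=> /andP[_]; apply: submx_trans.
by rewrite sub_capmx xF.
Qed.

End Direction.

(** * Incidence numbers of a polytopal complex *)

Section Incidence.
Variables (R : realFieldType) (p : nat) (V : choiceType) (pos : V -> 'rV[R]_p).
Implicit Types F G H : {fset V}.
Local Notation direction := (direction pos).
Local Notation dimf := (dimf pos).
Local Notation barycenter := (barycenter pos).

Lemma basis_row_free i (O : 'M[R]_(i, p)) F :
  dimf F = i -> (O :=: direction F)%MS -> row_free O.
Proof. by move=> dF eO; rewrite /row_free eO; apply/eqP. Qed.

Lemma incidence_basis i (OG : 'M[R]_(i, p)) F G :
  G `<=` F -> G != fset0 -> (OG :=: direction G)%MS ->
  (col_mx (barycenter G - barycenter F) OG <= direction F)%MS.
Proof.
move=> GF G0 eG; rewrite col_mx_sub eG direction_mono // andbT.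
apply: barycenter_diff => //; apply: contraNneq G0 => F0.
by rewrite F0 fsubset0 in GF.
Qed.

Variable o : forall i, {fset V} -> 'M[R]_(i, p).

(** The barycenter of a facet G differs from that of F in the value of the
    functional defining G, hence completes a basis of the direction of G to one
    of the direction of F. *)
Lemma incidence_neq0 i F G : is_face pos G F -> G != fset0 ->
  dimf G = i -> dimf F = i.+1 ->
  (o i G :=: direction G)%MS -> (o i.+1 F :=: direction F)%MS ->
  incidence pos o i G F != 0.
Proof.
move=> [c [b [hF eG]]] G0 dG dF eOG eOF.
have GF : G `<=` F by rewrite eG; apply: fset_sub.
have F0 : F != fset0 by apply: contraNneq G0 => F0; rewrite F0 fsubset0 in GF.
have hG v : v \in G -> dotmul c (pos v) = b by rewrite eG !inE => /andP[_ /eqP].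
have [v hv vb] : exists2 v, v \in F & dotmul c (pos v) != b.
  case: (boolP (F `<=` G)) => [FG|/fsubsetPn[v hv vG]]; last first.
    by exists v => //; apply: contra vG => /eqP e; rewrite eG !inE hv e /=.
  have E : F = G by apply/eqP; rewrite eqEfsubset FG.
  by move: dF; rewrite E dG => /eqP; rewrite ltn_eqF.
set g := barycenter G - barycenter F.
have gc : dotmul c g != 0.
  rewrite dotmulBr (barycenter_eq G0 hG) subr_eq0 eq_sym lt_eqF //.
  by apply: barycenter_lt => //; exists v.
rewrite /incidence sgz_eq0 -unitfE -unitmxE.
have sub := incidence_basis GF G0 eOG; rewrite -eOF in sub.
have /submxP[P eP] := sub.
have fO := basis_row_free dF eOF.
have rk : row_free (col_mx g (o i G)).
  have fG := basis_row_free dG eOG.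
  rewrite /row_free -addsmxE mxrank_disjoint_sum.
    rewrite (eqP fG) rank_rV (_ : g != 0) //; apply: contraNneq gc => ->.
    by rewrite -[0](subrr g) dotmulBr subrr.
  apply/eqP/rowV0P => x; rewrite sub_capmx => /andP[/sub_rVP[a ->]].
  rewrite eOG => /direction_dot - /(_ _ _ hG); rewrite dotmulZr.
  by move=> /eqP; rewrite mulf_eq0 (negPf gc) orbF => /eqP ->; rewrite scale0r.
rewrite eP -mulmxA unitmx_mul; apply/andP; split.
  rewrite -row_free_unit; apply/row_freeP; move/row_freeP: rk => [Q]; rewrite eP.
  by rewrite -mulmxA => eQ; exists (o i.+1 F *m Q).
by rewrite unitmxE unitfE gt_eqF // gram_det_gt0.
Qed.

End Incidence.

Section Diamond.
Variables (R : realFieldType) (p : nat) (V : choiceType) (pos : V -> 'rV[R]_p).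
Implicit Types F G H : {fset V}.
Local Notation direction := (direction pos).
Local Notation dimf := (dimf pos).
Local Notation barycenter := (barycenter pos).

Lemma face_fsub F G : is_face pos G F -> G `<=` F.
Proof. by case=> c [b [_ ->]]; apply: fset_sub. Qed.

Lemma is_face_restrict F F' G : is_face pos G F -> G `<=` F' -> F' `<=` F ->
  is_face pos G F'.
Proof.
move=> [c [b [hF eG]]] GF' FF; exists c, b; split=> [v /(fsubsetP FF)|]; first exact: hF.
apply/fsetP => v; rewrite eG !inE.
case: (boolP (v \in F')) => /= [/(fsubsetP FF) -> //|nv].
apply: contraNF nv => h; apply: (fsubsetP GF'); rewrite eG !inE; exact: h.
Qed.

Lemma face_dimf_lt F G : is_face pos G F -> G != fset0 -> G != F ->
  (dimf G < dimf F)%N.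
Proof.
move=> fG G0 GF; have sub := face_fsub fG; have [c [b [_ eG]]] := fG.
apply: (dimf_lt (c := c) (b := b)) => // [v|].
  by rewrite eG !inE => /andP[_ /eqP].
have /fsubsetPn[v hv vG] : ~~ (F `<=` G).
  by apply: contra GF => FG; rewrite eqEfsubset sub.
by exists v => //; apply: contra vG => /eqP e; rewrite eG !inE hv e /=.
Qed.

Lemma faces_eq F G1 G2 : is_face pos G1 F -> is_face pos G2 F -> G1 != fset0 ->
  dimf G1 = dimf G2 -> G1 `<=` G2 -> G1 = G2.
Proof.
move=> [c [b [h1 e1]]] f2 G10 d12 sub; apply/eqP; apply: contraT => ne.
have : is_face pos G1 G2.
  exists c, b; split=> [v hv|]; first by rewrite h1 // (fsubsetP (face_fsub f2)).
  apply/fsetP => v; rewrite e1 !inE; case: (boolP (v \in G2)) => hv.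
    by rewrite (fsubsetP (face_fsub f2)).
  apply: contraNF hv => hv; apply: (fsubsetP sub).
  by rewrite e1 !inE.
by move/face_dimf_lt => /(_ G10 ne); rewrite d12 ltnn.
Qed.

Variable o : forall i, {fset V} -> 'M[R]_(i, p).

(** In the plane of F modulo H, the vectors g1 and g2 pointing to the two facets
    lie on opposite sides of the vector h pointing to H: a positive combination
    of g1 and g2 is a multiple of h.  So the determinants which [sgz_det_step]
    attaches to G1 and G2 have opposite signs. *)
Lemma incidence_opposite i F G1 G2 H :
  is_face pos G1 F -> is_face pos G2 F -> G1 != G2 ->
  H `<=` G1 -> H `<=` G2 -> H != fset0 ->
  dimf H = i -> dimf G1 = i.+1 -> dimf G2 = i.+1 -> dimf F = i.+2 ->
  (o i H :=: direction H)%MS ->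
  (o i.+1 G1 :=: direction G1)%MS -> (o i.+1 G2 :=: direction G2)%MS ->
  incidence pos o i H G1 * incidence pos o i.+1 G1 F
  = - (incidence pos o i H G2 * incidence pos o i.+1 G2 F).
Proof.
move=> f1 f2 ne12 H1 H2 H0 dH d1 d2 dF eH e1 e2.
have ne0 G : H `<=` G -> G != fset0.
  by move=> HG; apply: contraNneq H0 => G0; rewrite -fsubset0 -G0.
have G10 := ne0 _ H1; have G20 := ne0 _ H2.
have [c1 [b1 [h1 E1]]] := f1; have [c2 [b2 [h2 E2]]] := f2.
have s1 := face_fsub f1; have s2 := face_fsub f2.
have F0 := ne0 _ (fsubset_trans H1 s1).
have k1 v : v \in G1 -> dotmul c1 (pos v) = b1 by rewrite E1 !inE => /andP[_ /eqP].
have k2 v : v \in G2 -> dotmul c2 (pos v) = b2 by rewrite E2 !inE => /andP[_ /eqP].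
have ex2 : exists2 v, v \in G1 & dotmul c2 (pos v) != b2.
  have /fsubsetPn[v v1 v2] : ~~ (G1 `<=` G2).
    by apply: contra ne12 => sub; apply/eqP; apply: faces_eq f1 f2 _ _ sub; rewrite ?d1.
  exists v => //; apply: contra v2 => /eqP e.
  by rewrite E2 !inE e eqxx (fsubsetP s1) /=.
have ex1 : exists2 v, v \in G2 & dotmul c1 (pos v) != b1.
  have /fsubsetPn[v v2 v1] : ~~ (G2 `<=` G1).
    apply: contra ne12 => sub; rewrite eq_sym; apply/eqP.
    by apply: faces_eq f2 f1 _ _ sub; rewrite ?d1.
  exists v => //; apply: contra v1 => /eqP e.
  by rewrite E1 !inE e eqxx (fsubsetP s2) /=.
set h := barycenter H - barycenter F.
set g1 := barycenter G1 - barycenter F; set g2 := barycenter G2 - barycenter F.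
have st G : G `<=` F -> H `<=` G -> dimf G = i.+1 -> (o i.+1 G :=: direction G)%MS ->
    incidence pos o i H G * incidence pos o i.+1 G F
    = sgz (\det (col_mx (barycenter G - barycenter F)
             (col_mx h (o i H) : 'M_(i.+1, p)) *m (o i.+2 F)^T : 'M_i.+2)).
  move=> GF HG dG eG; rewrite /incidence.
  have e : barycenter H - barycenter G = h - (barycenter G - barycenter F).
    by rewrite /h opprB addrA subrK.
  rewrite e; apply: sgz_det_step; first exact: basis_row_free eG.
  by rewrite -e eG; apply: incidence_basis.
rewrite (st G1) // (st G2) // -/g1 -/g2 {st}.
set L := fun x : 'rV[R]_p => \det (col_mx x (col_mx h (o i H) : 'M_(i.+1, p))
                                    *m (o i.+2 F)^T : 'M_i.+2).
rewrite -[\det _]/(L g1) -[in RHS](_ : L g2 = \det _) //.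
pose p1 := b1 - dotmul c1 (barycenter F); pose p2 := b2 - dotmul c2 (barycenter F).
pose q1 := b1 - dotmul c1 (barycenter G2); pose q2 := b2 - dotmul c2 (barycenter G1).
have p1_gt0 : 0 < p1.
  rewrite subr_gt0 barycenter_lt //; have [v v2 ?] := ex1.
  by exists v => //; apply: (fsubsetP s2).
have p2_gt0 : 0 < p2.
  rewrite subr_gt0 barycenter_lt //; have [v v2 ?] := ex2.
  by exists v => //; apply: (fsubsetP s1).
have q1_gt0 : 0 < q1.
  by rewrite subr_gt0 barycenter_lt // => v /(fsubsetP s2); apply: h1.
have q2_gt0 : 0 < q2.
  by rewrite subr_gt0 barycenter_lt // => v /(fsubsetP s1); apply: h2.
(* The weights for which both functionals vanish on a g1 + b g2 - l h. *)
pose a := q1 * p2; pose b := q2 * p1; pose l := q1 * p2 + q2 * p1 - q1 * q2.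
pose x := a *: g1 + b *: g2 - l *: h.
have xH : (x <= direction H)%MS.
  have xF : (x <= direction F)%MS.
    apply: addmx_sub; first apply: addmx_sub.
    - by rewrite scalemx_sub // barycenter_diff.
    - by rewrite scalemx_sub // barycenter_diff.
    by rewrite eqmx_opp scalemx_sub // barycenter_diff // (fsubset_trans H1).
  have x1 : dotmul c1 x = 0.
    rewrite dotmulBr dotmulDr !dotmulZr !dotmulBr.
    rewrite (barycenter_eq G10 k1) (barycenter_eq (F := H) (b := b1)) //; last first.
      by move=> v /(fsubsetP H1); apply: k1.
    by rewrite /a /b /l /p1 /p2 /q1 /q2; ring.
  have x2 : dotmul c2 x = 0.
    rewrite dotmulBr dotmulDr !dotmulZr !dotmulBr.
    rewrite (barycenter_eq G20 k2) (barycenter_eq (F := H) (b := b2)) //; last first.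
      by move=> v /(fsubsetP H2); apply: k2.
    by rewrite /a /b /l /p1 /p2 /q1 /q2; ring.
  apply: (direction_facet (F := G1) (c := c2) (b := b2)) => //.
  - by rewrite d1 dH.
  - by move=> v /(fsubsetP H2); apply: k2.
  apply: (direction_facet (F := F) (c := c1) (b := b1)) => //.
  - by rewrite dF d1.
  by have [v v2 ?] := ex1; exists v => //; apply: (fsubsetP s2).
have : a * L g1 + b * L g2 = 0.
  rewrite -det_col_mx_linear; apply: det_col_mx_sub.
  have -> : a *: g1 + b *: g2 = x + l *: h by rewrite subrK.
  have : ((x + l *: h)%R <= h + direction H)%MS.
    apply: addmx_sub.
      exact: submx_trans xH (addsmxSr _ _).
    by rewrite scalemx_sub // addsmxSl.
  by rewrite -(adds_eqmx (eqmx_refl h) eH) addsmxE.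
have a_gt0 : 0 < a by rewrite mulr_gt0.
have b_gt0 : 0 < b by rewrite mulr_gt0.
move=> /eqP; rewrite addr_eq0 => /eqP e.
have -> : L g1 = - (a^-1 * b * L g2) by rewrite -mulrA -mulrN -e mulKf // gt_eqF.
by rewrite sgzN sgzM gtr0_sgz ?mul1r // mulr_gt0 ?invr_gt0.
Qed.

Lemma argmax_fset (f : V -> R) (D : {fset V}) : D != fset0 ->
  exists2 u, u \in D & forall v, v \in D -> f v <= f u.
Proof.
move=> /fset0Pn[u0 hu0].
have [u _ h] := @arg_maxP _ _ _ [` hu0] xpredT (fun x : D => f (val x)) isT.
by exists (val u); [exact: valP | move=> v hv; apply: (h [` hv])].
Qed.

(** Rotate the supporting hyperplane of G1 around H until it meets another
    vertex of F. *)
Lemma second_facet i F G1 H : is_face pos G1 F -> is_face pos H G1 ->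
  H != fset0 -> dimf H = i -> dimf G1 = i.+1 -> dimf F = i.+2 ->
  exists G2, [/\ is_face pos G2 F, H `<=` G2, G2 != G1 & dimf G2 = i.+1].
Proof.
move=> f1 fH H0 dH d1 dF.
have [c1 [b1 [h1 E1]]] := f1; have [c [b [hc EH]]] := fH.
have s1 := face_fsub f1; have sH := face_fsub fH.
have k1 v : v \in G1 -> dotmul c1 (pos v) = b1 by rewrite E1 !inE => /andP[_ /eqP].
have kH v : v \in H -> dotmul c (pos v) = b by rewrite EH !inE => /andP[_ /eqP].
have D0 : F `\` G1 != fset0.
  rewrite fsetD_eq0; apply: contraNN (H0) => sub.
  have E : F = G1 by apply/eqP; rewrite eqEfsubset sub.
  by move: dF; rewrite E d1 => /eqP; rewrite ltn_eqF.
pose t v := (dotmul c (pos v) - b) / (b1 - dotmul c1 (pos v)).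
have [u uD hu] := argmax_fset t D0.
have gt0 v : v \in F `\` G1 -> 0 < b1 - dotmul c1 (pos v).
  rewrite inE => /andP[vG vF]; rewrite subr_gt0 lt_neqAle h1 // andbT.
  by apply: contra vG => /eqP e; rewrite E1 !inE vF e /=.
(* l is the smallest slope for which the rotated inequality is valid on F. *)
pose l := t u; pose c' := c + l *: c1; pose b' := b + l * b1.
have val v : b' - dotmul c' (pos v) =
    (b - dotmul c (pos v)) + l * (b1 - dotmul c1 (pos v)).
  by rewrite /b' /c' dotmulDl dotmulZl; ring.
pose G2 := [fset v in F | dotmul c' (pos v) == b'].
have f2 : is_face pos G2 F.
  exists c', b'; split=> // v vF; rewrite -subr_ge0 val.
  case: (boolP (v \in G1)) => v1; first by rewrite k1 // subrr mulr0 addr0 subr_ge0 hc.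
  have vD : v \in F `\` G1 by rewrite inE v1.
  have := hu _ vD; rewrite -/l /t ler_pdivrMr ?gt0 //; lra.
have u2 : u \in G2.
  have uF : u \in F by move: uD; rewrite inE => /andP[].
  have nz : b1 - dotmul c1 (pos u) != 0 by rewrite gt_eqF ?gt0.
  by rewrite !inE uF /= eq_sym -subr_eq0 val /l /t divfK // subrKA subrr.
have H2 : H `<=` G2.
  apply/fsubsetP => v vH; have v1 := fsubsetP sH _ vH.
  rewrite !inE (fsubsetP s1) //= eq_sym -subr_eq0 val.
  by rewrite k1 // kH // !subrr mulr0 addr0.
have n1 : u \notin G1 by move: uD; rewrite inE => /andP[].
exists G2; split=> //; first by apply: contraNneq n1 => <-.
apply/eqP; rewrite eqn_leq -ltnS -dF; apply/andP; split.
  apply: face_dimf_lt => //; first by apply/fset0Pn; exists u.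
  have /fsubsetPn[v v1 vH] : ~~ (G1 `<=` H).
    apply/negP => sub; have E : G1 = H by apply/eqP; rewrite eqEfsubset sub.
    by move: d1; rewrite E dH => /eqP; rewrite ltn_eqF.
  apply: contraNneq vH => E; have := fsubsetP s1 _ v1; rewrite -E !inE.
  rewrite (fsubsetP s1) //= eq_sym -subr_eq0 val k1 // subrr mulr0 addr0.
  by rewrite subr_eq0 EH !inE v1 eq_sym.
rewrite -dH; apply: (dimf_lt (c := c1) (b := b1)) => //.
  by move=> v /(fsubsetP sH); apply: k1.
by exists u => //; rewrite eq_sym -subr_eq0 gt_eqF // gt0.
Qed.

End Diamond.

Section BoundaryBoundary.
Variables (R : realFieldType) (p : nat) (V : choiceType) (pos : V -> 'rV[R]_p).
Implicit Types F G H : {fset V}.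
Variables (X : {fset {fset V}}) (hX : polytopal_complex pos X).
Variables (o : forall i, {fset V} -> 'M[R]_(i, p)) (ho : orientation pos X o).
Local Notation dimf := (dimf pos).

(** Cells meet in common faces, so G is the convex hull of one of its own faces,
    and each vertex of G is extreme. *)
Lemma subcell_is_face F G : F \in X -> G \in X -> G `<=` F -> is_face pos G F.
Proof.
move=> FX GX GF; have [hv _ hI] := hX.
have [H [fF fG cI]] := hI _ _ FX GX.
suff -> : G = H by [].
apply/eqP; rewrite eqEfsubset (face_fsub fG) andbT.
apply/fsubsetP => v vG; apply: contraT => vH.
have conv1 A : v \in A -> conv pos A (pos v).
  move=> vA; exists (fun w => (w == v)%:R); split => [w _||].
  - exact: ler0n.
  - rewrite (big_rem v) //= eqxx big_seq big1 ?addr0 // => w.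
    by rewrite mem_rem_uniq ?fset_uniq // inE => /andP[/negPf ->].
  - rewrite (big_rem v) //= eqxx scale1r big_seq big1 ?addr0 // => w.
    by rewrite mem_rem_uniq ?fset_uniq // inE => /andP[/negPf ->]; rewrite scale0r.
have [w [w0 w1 wx]] : conv pos H (pos v).
  by apply/cI; split; apply: conv1 => //; apply: (fsubsetP GF).
case: (hv _ _ GX vG); exists (fun u => if u \in H then w u else 0).
have HG : H `<=` G `\ v.
  apply/fsubsetP => u uH; rewrite !inE (fsubsetP (face_fsub fG)) // andbT.
  by apply: contraNneq vH => <-.
split=> [u _||]; first by case: ifP => // /w0.
  rewrite -big_mkcond /= -w1 -big_filter; apply: perm_big.
  apply: uniq_perm; rewrite ?filter_uniq ?fset_uniq // => u.
  by rewrite mem_filter; apply: andb_idr; apply: (fsubsetP HG).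
rewrite wx; under [RHS]eq_bigr do rewrite (fun_if (fun a => a *: _)) scale0r.
rewrite -big_mkcond /= -[RHS]big_filter; apply: perm_big.
apply: uniq_perm; rewrite ?filter_uniq ?fset_uniq // => u.
by rewrite mem_filter; apply/esym/andb_idr; apply: (fsubsetP HG).
Qed.

Lemma cellsP i F : reflect [/\ F \in X, F != fset0 & dimf F = i] (F \in cells pos X i).
Proof.
rewrite !inE /=; apply: (iffP and3P) => -[a b c]; split=> //; exact/eqP.
Qed.

Lemma cell_basis i F : F \in cells pos X i -> (o i F :=: direction pos F)%MS.
Proof. by move=> /cellsP[FX F0 dF]; have := ho FX F0; rewrite dF. Qed.

Definition signed_incidence i (G F : {fset V}) : int :=
  if G `<=` F then incidence pos o i G F else 0.

Lemma cell_incidence_neq0 i F G : F \in cells pos X i.+1 -> G \in cells pos X i ->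
  G `<=` F -> incidence pos o i G F != 0.
Proof.
move=> hF hG GF; have [FX _ dF] := cellsP _ _ hF; have [GX G0 dG] := cellsP _ _ hG.
apply: incidence_neq0 (dG) (dF) _ _ => //; try exact: cell_basis.
exact: subcell_is_face.
Qed.

(** Any two facets of F containing H contribute opposite nonzero terms by
    [incidence_opposite].  Hence there cannot be three of them, and by
    [second_facet] there cannot be exactly one. *)
Lemma incidence_sum i F H : F \in cells pos X i.+2 -> H \in cells pos X i ->
  \sum_(G : cells pos X i.+1)
    signed_incidence i.+1 (val G) F * signed_incidence i H (val G) = 0.
Proof.
move=> hF hH; have [FX F0 dF] := cellsP _ _ hF; have [HX H0 dH] := cellsP _ _ hH.
pose btw (G : cells pos X i.+1) := (H `<=` val G) && (val G `<=` F).
case: (pickP btw) => [G1 /andP[H1 s1]|no]; last first.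
  apply: big1 => G _; rewrite /signed_incidence; have := no G; rewrite /btw.
  by case: ifP => _; case: ifP => //=; rewrite ?mulr0 ?mul0r.
have [X1 G10 d1] := cellsP _ _ (valP G1).
have f1 : is_face pos (val G1) F by apply: subcell_is_face.
have [G2 [f2 H2 ne21 d2]] := second_facet f1 (subcell_is_face X1 HX H1) H0 dH d1 dF.
have G20 : G2 != fset0 by apply: contraNneq H0 => e; rewrite -fsubset0 -e.
have X2 : G2 \in cells pos X i.+1.
  by apply/cellsP; split=> //; have [_ cl _] := hX; apply: cl f2.
pose G2' : cells pos X i.+1 := [` X2].
have opp (A B : cells pos X i.+1) : btw A -> btw B -> A != B ->
    incidence pos o i H (val A) * incidence pos o i.+1 (val A) F
    = - (incidence pos o i H (val B) * incidence pos o i.+1 (val B) F).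
  move=> /andP[HA AF] /andP[HB BF] ne.
  have [XA _ dA] := cellsP _ _ (valP A); have [XB _ dB] := cellsP _ _ (valP B).
  apply: incidence_opposite => //; try exact: subcell_is_face.
  - exact: cell_basis.
  - by apply: cell_basis; apply: valP.
  by apply: cell_basis; apply: valP.
have nz (A : cells pos X i.+1) : btw A ->
    incidence pos o i H (val A) * incidence pos o i.+1 (val A) F != 0.
  move=> /andP[HA AF]; rewrite mulf_neq0 //.
    by apply: cell_incidence_neq0 => //; apply: valP.
  by apply: cell_incidence_neq0 => //; apply: valP.
have b1 : btw G1 by rewrite /btw H1.
have b2 : btw G2' by rewrite /btw H2 (face_fsub f2).
have ne : G2' != G1 by apply: contra ne21 => /eqP <-.
have others (G : cells pos X i.+1) : G != G1 -> G != G2' -> ~~ btw G.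
  move=> n1 n2; apply/negP => bG.
  have e1 := opp _ _ bG b1 n1; have e2 := opp _ _ bG b2 n2.
  have e3 := opp _ _ b2 b1 ne; have := nz _ bG.
  have absurd (x y z : int) : x = - y -> x = - z -> z = - y -> x != 0 -> False.
    by clear => *; lia.
  exact: absurd e1 e2 e3.
rewrite (bigD1 G1) //= (bigD1 G2') //= big1 ?addr0 => [|G /andP[n1 n2]]; last first.
  have := others _ n1 n2; rewrite /btw /signed_incidence negb_and.
  by case: ifP => _; case: ifP => //=; rewrite ?mulr0 ?mul0r.
rewrite /signed_incidence s1 H1 H2 (face_fsub f2) //.
by rewrite mulrC (opp _ _ b1 b2) 1?eq_sym //= mulrC addrC mulrC subrr.
Qed.

End BoundaryBoundary.

Section EdgeIncidence.
Variables (R : realFieldType) (p : nat) (V : choiceType) (pos : V -> 'rV[R]_p).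

(** The analogue of [incidence_sum] with the empty face in place of H: the
    barycenter of an edge is its midpoint. *)
Lemma edge_incidence (o : forall i, {fset V} -> 'M[R]_(i, p)) (F : {fset V}) v w :
  v != w -> F = [fset v; w] ->
  incidence pos o 0 [fset w] F = - incidence pos o 0 [fset v] F.
Proof.
move=> vw eF; rewrite /incidence; set bF := barycenter pos F.
have b1 u : barycenter pos [fset u] = pos u.
  by rewrite /barycenter cardfs1 big_seq_fset1 invr1 scale1r.
have e : barycenter pos [fset w] - bF = (-1) *: (barycenter pos [fset v] - bF) + 0 *: 0.
  rewrite !b1 scale0r addr0 scaleN1r opprB; apply/eqP.
  rewrite subr_eq addrAC eq_sym subr_eq -mulr2n /bF /barycenter eF cardfs2 vw.
  rewrite big_fsetU1 ?inE // big_seq_fset1 -scaler_nat scalerA mulfV ?scale1r 1?addrC //.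
  by rewrite pnatr_eq0.
have -> : o 0%N [fset w] = o 0%N [fset v] by rewrite [LHS]flatmx0 [RHS]flatmx0.
by rewrite e det_col_mx_linear mul0r addr0 mulN1r sgzN.
Qed.

End EdgeIncidence.

(** * Regular subdivisions *)

Section RegularSubdivision.
Variables (R : realFieldType) (p : nat) (V : choiceType) (pos : V -> 'rV[R]_p).
Variables (W : V -> Prop) (h : V -> R).
Implicit Types F G H : {fset V}.

(** F is the set of vertices at which some affine function touches the height h
    from below, that is, the projection of a face of the lower hull of the lifted
    points (v, h v). *)
Definition lower_face F : Prop :=
  (forall v, v \in F -> W v) /\
  exists c b, forall v, W v ->
    dotmul c (pos v) + b <= h v /\ (dotmul c (pos v) + b == h v) = (v \in F).

Lemma lower_face_is_face F G : lower_face F -> lower_face G -> G `<=` F ->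
  is_face pos G F.
Proof.
move=> [WF [c [b hF]]] [_ [c' [b' hG]]] GF; exists (c' - c), (b - b').
have eF v : v \in F -> dotmul c (pos v) + b = h v.
  by move=> vF; apply/eqP; rewrite (hF v (WF v vF)).2.
split=> [v vF|].
  by have := (hG v (WF v vF)).1; rewrite -(eF v vF) dotmulBl; lra.
apply/fsetP => v; rewrite !inE; case: (boolP (v \in F)) => vF /=; last first.
  by apply: contraNF vF; apply: (fsubsetP GF).
rewrite -(hG v (WF v vF)).2 -(eF v vF) dotmulBl -subr_eq0 -[RHS]subr_eq0.
by congr (_ == _); ring.
Qed.

Lemma conv_affine F (w : V -> R) c b : \sum_(v <- F) w v = 1 ->
  \sum_(v <- F) w v * (dotmul c (pos v) + b)
  = dotmul c (\sum_(v <- F) w v *: pos v) + b.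
Proof.
move=> w1; under eq_bigr do rewrite mulrDr.
rewrite big_split /= -mulr_suml w1 mul1r dotmul_sumr; congr (_ + _).
by apply: eq_bigr => v _; rewrite dotmulZr.
Qed.

(** At a point x of the convex hull of F, the affine function of F takes the
    average of the heights of the vertices of F.  Any other affine minorant of h
    is at most that, and it can only agree if it touches h at all vertices that
    enter the average. *)
Lemma conv_height F x c b c' b' (w : V -> R) :
  (forall v, v \in F -> W v) ->
  (forall v, v \in F -> dotmul c (pos v) + b = h v) ->
  (forall v, W v -> dotmul c' (pos v) + b' <= h v) ->
  (forall v, v \in F -> 0 <= w v) -> \sum_(v <- F) w v = 1 ->
  x = \sum_(v <- F) w v *: pos v ->
  dotmul c' x + b' <= dotmul c x + b /\
  (dotmul c' x + b' = dotmul c x + b ->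
     forall v, v \in F -> w v != 0 -> dotmul c' (pos v) + b' = h v).
Proof.
move=> WF hF h' w0 w1 ->; rewrite -!conv_affine //.
have le v : v \in F -> w v * (dotmul c' (pos v) + b') <= w v * (dotmul c (pos v) + b).
  move=> vF; apply: ler_wpM2l; first exact: w0.
  by rewrite hF //; apply: h'; apply: WF.
split=> [|/eqP e v vF wv]; first by rewrite big_seq [leRHS]big_seq; apply: ler_sum.
apply/eqP; rewrite eq_le (h' v (WF v vF)) /=.
apply: contraTT e; rewrite -ltNge -hF // => lt; rewrite lt_eqF //.
rewrite (big_rem v) //= [ltRHS](big_rem v) //= ltr_leD //.
  by rewrite ltr_pM2l // lt_neqAle eq_sym wv w0.
by rewrite big_seq [leRHS]big_seq; apply: ler_sum => u /mem_rem; apply: le.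
Qed.

(** If x is in the convex hulls of F and of G, then the affine functions of F
    and G agree at x by [conv_height], so every vertex of F that contributes to x
    lies on the graph of the affine function of G, hence in G. *)
Theorem regular_complex (X : {fset {fset V}}) :
  (forall F, F \in X -> lower_face F) ->
  (forall v, W v -> lower_face [fset v]) ->
  (forall F G, F \in X -> is_face pos G F -> G \in X) ->
  polytopal_complex pos X.
Proof.
move=> hX hv cl; split=> // [F v FX vF [w [w0 w1 wx]]|F G FX GX].
  have [WF [c [b hF]]] := hX F FX; have [_ [c' [b' hV]]] := hv v (WF v vF).
  have WF' u : u \in F `\ v -> W u by rewrite !inE => /andP[_]; apply: WF.
  have eF u : u \in F `\ v -> dotmul c (pos u) + b = h u.
    by rewrite !inE => /andP[_ uF]; apply/eqP; rewrite (hF u (WF u uF)).2.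
  have [_] := conv_height WF' eF (fun u Wu => (hV u Wu).1) w0 w1 wx.
  have e1 : dotmul c (pos v) + b = h v by apply/eqP; rewrite (hF v (WF v vF)).2.
  have e2 : dotmul c' (pos v) + b' = h v.
    by apply/eqP; rewrite (hV v (WF v vF)).2 !inE.
  rewrite e1 e2 => /(_ erefl) allv.
  have : \sum_(u <- F `\ v) w u = 0.
    rewrite big_seq big1 // => u uF; apply/eqP; apply: contraT => wu.
    have /eqP := allv u uF wu; rewrite (hV u (WF' u uF)).2.
    by move: uF; rewrite !inE => /andP[/negPf ->].
  by rewrite w1 => /eqP; rewrite oner_eq0.
have [WF [c [b hF]]] := hX F FX; have [WG [c' [b' hG]]] := hX G GX.
have eF u : u \in F -> dotmul c (pos u) + b = h u.
  by move=> uF; apply/eqP; rewrite (hF u (WF u uF)).2.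
have eG u : u \in G -> dotmul c' (pos u) + b' = h u.
  by move=> uG; apply/eqP; rewrite (hG u (WG u uG)).2.
exists (F `&` G); split.
- exists (c' - c), (b - b'); split=> [v vF|].
    by have := (hG v (WF v vF)).1; rewrite -(eF v vF) dotmulBl; lra.
  apply/fsetP => v; rewrite !inE; case: (boolP (v \in F)) => vF //=.
  rewrite -(hG v (WF v vF)).2 -(eF v vF) dotmulBl -subr_eq0 -[RHS]subr_eq0.
  by congr (_ == _); ring.
- exists (c - c'), (b' - b); split=> [v vG|].
    by have := (hF v (WG v vG)).1; rewrite -(eG v vG) dotmulBl; lra.
  apply/fsetP => v; rewrite !inE; case: (boolP (v \in G)) => vG //=; rewrite ?andbT ?andbF //.
  rewrite -(hF v (WG v vG)).2 -(eG v vG) dotmulBl -subr_eq0 -[RHS]subr_eq0.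
  by congr (_ == _); ring.
have mono A B x : B `<=` A -> conv pos B x -> conv pos A x.
  move=> BA [w [w0 w1 wx]]; exists (fun u => if u \in B then w u else 0).
  have pB : perm_eq [seq u <- A | u \in B] B.
    apply: uniq_perm; rewrite ?filter_uniq ?fset_uniq // => u.
    by rewrite mem_filter; apply: andb_idr; apply: (fsubsetP BA).
  split=> [u _||]; first by case: ifP => // /w0.
    by rewrite -big_mkcond /= -big_filter (perm_big _ pB).
  under eq_bigr do rewrite (fun_if (fun a => a *: _)) scale0r.
  by rewrite -big_mkcond /= -big_filter (perm_big _ pB).
move=> x; split=> [[[w [w0 w1 wx]] [w' [w0' w1' wx']]]|hx]; last first.
  by split; apply: mono hx; rewrite ?fsubsetIl ?fsubsetIr.
have [le1 all1] := conv_height WF eF (fun u Wu => (hG u Wu).1) w0 w1 wx.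
have [le2 _] := conv_height WG eG (fun u Wu => (hF u Wu).1) w0' w1' wx'.
have {}all1 := all1 (le_anti (introT andP (conj le1 le2))).
have out v : v \in F -> v \notin G -> w v = 0.
  move=> vF vG; apply/eqP; apply: contraNT vG => wv.
  by rewrite -(hG v (WF v vF)).2 all1.
have pI : perm_eq [seq u <- F | u \in G] (F `&` G).
  apply: uniq_perm; rewrite ?filter_uniq ?fset_uniq // => u.
  by rewrite mem_filter inE andbC.
exists w; split=> [v||]; first by rewrite inE => /andP[/w0].
  rewrite -(perm_big _ pI) big_filter -w1 big_mkcond /= big_seq [RHS]big_seq.
  by apply: eq_bigr => v vF; case: ifP => // /negbT vG; rewrite out.
rewrite wx -(perm_big _ pI) big_filter [RHS]big_mkcond /= big_seq [RHS]big_seq.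
by apply: eq_bigr => v vF; case: ifP => // /negbT vG; rewrite out ?scale0r.
Qed.

End RegularSubdivision.

(** * Exactness from a filtration with Koszul layers *)

Section KoszulFiltration.
Variables (k : fieldType) (n : nat).
Local Notation S := {mpoly k[n]}.
Variables (B : nat -> finType).
Variables (delta : forall i, B i.+1 -> B i -> S) (eps : B 0%N -> S).
Variables (top : forall i, B i -> 'X_{1..n}) (dirs : forall i, B i -> {set 'I_n}).
Variables (adm : 'X_{1..n} -> {set 'I_n}) (wt : 'X_{1..n} -> nat).

Hypothesis card_dirs : forall i (x : B i), #|dirs x| = i.
Hypothesis dirs_adm : forall i (x : B i), dirs x \subset adm (top x).
Hypothesis cell_inj : forall i (x y : B i),
  top x = top y -> dirs x = dirs y -> x = y.
Hypothesis cell_ex : forall i j (x : B i) (s : {set 'I_n}),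
  s \subset adm (top x) -> #|s| = j ->
  exists2 y : B j, top y = top x & dirs y = s.
Hypothesis eps_top : forall x, eps x = 'X_[top x].
Hypothesis delta_tri : forall i (x : B i.+1) (y : B i), delta x y != 0 ->
  (top y = top x /\ dirs y \subset dirs x) \/ (wt (top y) < wt (top x))%N.
Hypothesis delta_koszul : forall i (x : B i.+1) (y : B i) j,
  top x = top y -> j \notin dirs y -> dirs x = j |: dirs y ->
  exists2 a, a != 0 & delta x y = a *: 'X_j.
Hypothesis delta_delta : forall i c,
  free_map (@delta i) (free_map (@delta i.+1) c) = 0.
Hypothesis eps_delta : forall c, augment eps (free_map (@delta 0%N) c) = 0.
Hypothesis unique_critical : forall (x y : B 0%N) (b : 'X_{1..n}),
  (top x <= b)%MM -> (top y <= b)%MM ->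
  (forall j, j \in adm (top x) -> top x j = b j) ->
  (forall j, j \in adm (top y) -> top y j = b j) -> x = y.

Lemma sub_ffunE (T : finType) (c d : {ffun T -> S}) x : (c - d) x = c x - d x.
Proof. by rewrite !ffunE. Qed.

Lemma free_mapB i (c c' : {ffun B i.+1 -> S}) :
  free_map (@delta i) (c - c') = free_map (@delta i) c - free_map (@delta i) c'.
Proof.
apply/ffunP => y; rewrite !ffunE -sumrB; apply: eq_bigr => x _.
by rewrite !ffunE mulrBl.
Qed.

Lemma free_mapD i (c c' : {ffun B i.+1 -> S}) :
  free_map (@delta i) (c + c') = free_map (@delta i) c + free_map (@delta i) c'.
Proof.
apply/ffunP => y; rewrite !ffunE -big_split; apply: eq_bigr => x _.
by rewrite !ffunE mulrDl.
Qed.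

Lemma free_map0 i : free_map (@delta i) 0 = 0.
Proof.
by apply/ffunP => y; rewrite !ffunE big1 // => x _; rewrite ffunE mul0r.
Qed.

Lemma free_mapZ i (a : k) (c : {ffun B i.+1 -> S}) :
  free_map (@delta i) (a *: c) = a *: free_map (@delta i) c.
Proof.
apply/ffunP => y; rewrite !ffunE scaler_sumr; apply: eq_bigr => x _.
by rewrite !ffunE scalerAl.
Qed.

Lemma free_map_sum i (I : Type) (r : seq I) (P : pred I) (f : I -> {ffun B i.+1 -> S}) :
  free_map (@delta i) (\sum_(l <- r | P l) f l)
  = \sum_(l <- r | P l) free_map (@delta i) (f l).
Proof.
elim/big_rec2: _ => [|l y x _ <-]; first exact: free_map0.
by rewrite free_mapD.
Qed.

Lemma augmentB (c c' : {ffun B 0%N -> S}) :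
  augment eps (c - c') = augment eps c - augment eps c'.
Proof.
by rewrite /augment -sumrB; apply: eq_bigr => x _; rewrite !ffunE mulrBl.
Qed.

Lemma mcoeff_mulX_neq0 (q : S) m b : (q * 'X_[m])@_b != 0 ->
  exists2 a, b = (a + m)%MM & q@_a != 0.
Proof.
rewrite -mcoeff_msupp => h.
have := perm_mem (msuppMX q m) b; rewrite h => /esym /mapP[a ha ->].
by exists a; [rewrite addmC | rewrite -mcoeff_msupp].
Qed.

(** The term 'X_[a] of the basis element x lies in the strand of multidegree
    b = a + top x + dirs x.  These are the admissible directions j with
    (top x) j < b j; they depend only on b and on top x, see [open_dirs_shift]. *)
Definition open_dirs i (x : B i) (a : 'X_{1..n}) : {set 'I_n} :=
  [set j in adm (top x) | (j \in dirs x) || (0 < a j)%N].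

Definition pivot i (x : B i) a : option 'I_n := [pick j in open_dirs x a].

(** Toggling the pivot pairs the terms of a strand with a fixed top; the
    liftable ones are the lower members of their pairs.  As the pivot is a
    function of the open directions, both members have the same pivot. *)
Definition liftable i (x : B i) a : bool :=
  if pivot x a is Some j then j \notin dirs x else false.

Lemma open_dirs_shift i (x : B i.+1) (y : B i) j a :
  top x = top y -> dirs x = j |: dirs y -> open_dirs x a = open_dirs y (a + U_(j))%MM.
Proof.
move=> et ed; apply/setP => l; rewrite !inE et ed !inE mnmDE mnm1E addn_gt0.
by rewrite [j == l]eq_sym; case: (l == j); rewrite /= ?orbT ?orbF.
Qed.

Lemma pivot_in i (x : B i) a j : pivot x a = Some j ->
  j \in adm (top x) /\ (j \in dirs x) || (0 < a j)%N.
Proof.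
by rewrite /pivot; case: pickP => // l; rewrite !inE => /andP[? ?] [<-].
Qed.

Lemma lower_dirs i (x : B i.+1) (y : B i) : dirs y \subset dirs x ->
  exists2 j, j \notin dirs y & dirs x = j |: dirs y.
Proof.
move=> sub; have : (#|dirs x :\: dirs y| == 1)%N.
  by rewrite cardsD (setIidPr sub) !card_dirs subSnn.
move=> /cards1P[j ej]; have : j \in dirs x :\: dirs y by rewrite ej set11.
rewrite inE => /andP[jy jx]; exists j => //.
apply/setP => l; move/setP/(_ l): ej; rewrite !inE.
by case: (boolP (l \in dirs y)) => [/(subsetP sub) ->|_ /= ->]; rewrite ?orbT ?orbF.
Qed.

(** The upper partner of a liftable term, divided by the coefficient of the
    term in its boundary. *)
Definition lift_term i (x : B i) (a : 'X_{1..n}) : {ffun B i.+1 -> S} :=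
  [ffun y => if pivot x a is Some j then
     if [&& j \notin dirs x, top y == top x & dirs y == j |: dirs x]
     then ((delta y x)@_(U_(j)))^-1 *: 'X_[(a - U_(j))%MM] else 0
   else 0].

Lemma lift_term_eq0 i (x : B i) a : ~~ liftable x a -> lift_term x a = 0.
Proof.
rewrite /liftable => h; apply/ffunP => y; rewrite !ffunE.
by case: (pivot x a) h => // j; rewrite negbK => ->.
Qed.

(** In the boundary of the upper partner, a term with the same top still
    contains the pivot in its directions, unless it is the given term; all
    others have tops of smaller weight. *)
Lemma lift_term_boundary i (x x' : B i) a a' : liftable x a -> liftable x' a' ->
  (wt (top x) <= wt (top x'))%N ->
  (free_map (@delta i) (lift_term x a) x')@_a' = ((x == x') && (a == a'))%:R.
Proof.
rewrite /liftable; case E: (pivot x a) => [j|] // jx.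
case E': (pivot x' a') => [l|] // lx' wle.
have [jadm] := pivot_in E; rewrite (negPf jx) /= => aj.
have jU : (U_(j) <= a)%MM.
  by apply/mnm_lepP => l0; rewrite mnm1E; case: eqP => [<-|].
have [y ty dy] : exists2 y : B i.+1, top y = top x & dirs y = j |: dirs x.
  apply: cell_ex; first by rewrite subUset sub1set jadm dirs_adm.
  by rewrite cardsU1 jx card_dirs.
have [al al0 eal] := delta_koszul ty jx dy.
have -> : free_map (@delta i) (lift_term x a) x'
    = al^-1 *: 'X_[(a - U_(j))%MM] * delta y x'.
  rewrite ffunE (bigD1 y) //= big1 ?addr0 => [|y' ney].
    rewrite ffunE E jx ty eqxx dy eqxx /= eal mcoeffZ mcoeffX eqxx mulr1.
    by [].
  rewrite ffunE E jx /=; case: ifP => [/andP[/eqP t /eqP d]|]; last by rewrite mul0r.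
  by case/eqP: ney; apply: cell_inj; rewrite ?t ?d.
have [d0|dn0] := eqVneq (delta y x') 0.
  rewrite d0 mulr0 mcoeff0; case: eqP => // ex; move: d0; rewrite -ex eal.
  move/(congr1 (mcoeff U_(j))); rewrite mcoeffZ mcoeffX eqxx mulr1 mcoeff0.
  by move/eqP; rewrite (negPf al0).
have [[tx' sub]|] := delta_tri dn0; last by rewrite ty ltnNge wle.
have [j' j'x' dy'] := lower_dirs sub.
have [be be0 ebe] := delta_koszul (esym tx') j'x' dy'.
rewrite ebe -scalerAl -scalerAr scalerA -mpolyXD mcoeffZ mcoeffX.
case: (eqVneq (a - U_(j) + U_(j'))%MM a') => [ea'|nea]; last first.
  rewrite mulr0; case: eqP => // ex; case: eqP => // ea; case/eqP: nea.
  move: j'x'; rewrite -ex => j'x; have : j' \in dirs y by rewrite dy' setU11.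
  by rewrite dy !inE (negPf j'x) orbF => /eqP ->; rewrite submK -?ea.
have : pivot x' a' = pivot x a.
  rewrite /pivot -ea' -(open_dirs_shift _ (esym tx') dy') (open_dirs_shift _ ty dy).
  by rewrite submK.
rewrite E E' => -[elj]; rewrite elj in lx'.
have ejj : j = j'.
  have : j \in dirs y by rewrite dy setU11.
  by rewrite dy' !inE (negPf lx') orbF => /eqP.
have ex : x = x'.
  apply: cell_inj; first by rewrite tx' ty.
  rewrite -(setU1K jx) -dy dy' -ejj setU1K //.
move: ea'; rewrite -ejj submK // => ea; rewrite ex ea !eqxx /=.
rewrite -ejj in ebe; rewrite -ex eal in ebe.
have /eqP := congr1 (mcoeff U_(j)) ebe.
by rewrite !mcoeffZ mcoeffX eqxx !mulr1 => /eqP <-; rewrite mulVf.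
Qed.

(** Lifting all liftable terms of c at once and subtracting the boundary removes
    the liftable terms of maximal weight; all liftable terms that it creates are
    lighter. *)
Lemma kill_liftable i (c : {ffun B i -> S}) W :
  (forall x a, liftable x a -> (c x)@_a != 0 -> (wt (top x) < W)%N) ->
  exists b, forall x a, liftable x a -> ((c - free_map (@delta i) b) x)@_a = 0.
Proof.
elim: W c => [|W IH] c hc.
  exists 0 => x a lx; rewrite free_map0 subr0; apply/eqP.
  by apply: contraT => /(hc _ _ lx).
pose b := \sum_x \sum_(a <- msupp (c x)) (c x)@_a *: lift_term x a.
have key x' a' : liftable x' a' -> (W <= wt (top x'))%N ->
    (free_map (@delta i) b x')@_a' = (c x')@_a'.
  move=> lx' wx'; rewrite /b free_map_sum sum_ffunE raddf_sum (bigD1 x') //=.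
  rewrite [X in _ + X]big1 ?addr0 => [|x nex].
    rewrite free_map_sum sum_ffunE raddf_sum /=.
    rewrite (eq_big_seq (fun a => (c x')@_a * (a == a')%:R)) => [|a ha]; last first.
      rewrite free_mapZ ffunE mcoeffZ.
      case: (boolP (liftable x' a)) => la; first by rewrite lift_term_boundary // eqxx.
      rewrite lift_term_eq0 // free_map0 ffunE mcoeff0.
      by case: eqP => [ea|]; rewrite ?mulr0 //; rewrite ea lx' in la.
    case: (boolP (a' \in msupp (c x'))) => ha'.
      rewrite (big_rem a') //= eqxx mulr1 big_seq big1 ?addr0 // => a.
      by rewrite mem_rem_uniq ?msupp_uniq // inE => /andP[/negPf -> _]; rewrite mulr0.
    rewrite (memN_msupp_eq0 ha') big_seq big1 // => a ha.
    case: eqP => [ea|]; rewrite ?mulr0 //.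
    by rewrite -ea ha in ha'.
  rewrite free_map_sum sum_ffunE raddf_sum /= big_seq big1 // => a ha.
  rewrite free_mapZ ffunE mcoeffZ.
  case: (boolP (liftable x a)) => la; last first.
    by rewrite lift_term_eq0 // free_map0 ffunE mcoeff0 mulr0.
  rewrite lift_term_boundary // ?(negPf nex) ?mulr0 //.
  by apply: leq_trans wx'; rewrite -ltnS (hc _ a) // -mcoeff_msupp.
have [x a lx|b' hb'] := IH (c - free_map (@delta i) b).
  rewrite ltnNge; apply: contraNN => wx.
  by rewrite sub_ffunE mcoeffB key // subrr.
exists (b + b') => x a lx.
by rewrite free_mapD opprD addrA hb'.
Qed.

(** Terms in degree 0 that cannot be lifted are critical, and each multidegree
    has one critical vertex, so nothing can cancel in the augmentation. *)
Lemma unliftable_cycle0 (c : {ffun B 0%N -> S}) :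
  (forall x a, liftable x a -> (c x)@_a = 0) -> augment eps c = 0 -> c = 0.
Proof.
move=> nl ec; have crit x a : (c x)@_a != 0 -> forall j, j \in adm (top x) -> a j = 0%N.
  move=> ca j jx; apply/eqP; apply: contraR ca; rewrite -lt0n => aj.
  rewrite nl // /liftable /pivot; case: pickP => [l _|/(_ j)].
    by move/eqP: (card_dirs x); rewrite cards_eq0 => /eqP ->; rewrite inE.
  by rewrite !inE jx aj orbT.
apply/ffunP => x; rewrite [RHS]ffunE; apply/mpolyP => a; rewrite mcoeff0.
apply/eqP; apply: contraT => ca.
have := congr1 (mcoeff (top x + a)%MM) ec; rewrite mcoeff0 /augment raddf_sum /=.
rewrite (bigD1 x) //= eps_top mcoeffMX big1 ?addr0 => [e|y ney]; first by rewrite e eqxx in ca.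
apply/eqP; apply: contraNT ney; rewrite eps_top => /mcoeff_mulX_neq0[a' ea ca'].
apply/eqP; apply: (unique_critical (b := (top x + a)%MM)).
- by rewrite ea; apply: lem_addl.
- exact: lem_addr.
- by move=> j jy; rewrite ea mnmDE (crit _ _ ca').
- by move=> j jx; rewrite mnmDE (crit _ _ ca) // addn0.
Qed.

(** In a term of maximal weight drop the pivot: in the boundary, the resulting
    term can only come from this one. *)
Lemma unliftable_cycle i (c : {ffun B i.+1 -> S}) :
  (forall x a, liftable x a -> (c x)@_a = 0) -> free_map (@delta i) c = 0 -> c = 0.
Proof.
move=> nl ec; apply/eqP; apply: contraT => c0.
have [x0 cx0] : exists x, c x != 0.
  apply/existsP; apply: contraNT c0 => /existsPn h; apply/eqP/ffunP => x.
  by rewrite [RHS]ffunE; apply/eqP; have := h x; rewrite negbK.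
case: (@arg_maxnP _ x0 (fun x => c x != 0) (fun x => wt (top x)) cx0) => x cx max.
have [a ca] : exists a, (c x)@_a != 0.
  by exists (mlead (c x)); rewrite mleadc_eq0.
case E: (pivot x a) => [j|]; last first.
  have := card_dirs x; move: E; rewrite /pivot; case: pickP => // none _.
  suff -> : dirs x = set0 by rewrite cards0.
  apply/setP => j; rewrite inE; apply/negbTE/negP => jx.
  have := none j; rewrite !inE jx /= andbT => /negP; apply.
  exact: (subsetP (dirs_adm x)).
have jx : j \in dirs x.
  by apply: contraR ca => jx; rewrite nl // /liftable E.
have [y ty dy] : exists2 y : B i, top y = top x & dirs y = dirs x :\ j.
  apply: cell_ex; first by apply: subset_trans (subD1set _ _) (dirs_adm x).
  by apply/eqP; rewrite -(eqn_add2l (j \in dirs x)) -cardsD1 jx card_dirs.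
have jy : j \notin dirs y by rewrite dy !inE eqxx.
have dx : dirs x = j |: dirs y by rewrite dy setD1K.
have [al al0 eal] := delta_koszul (esym ty) jy dx.
have := congr1 (fun f : {ffun B i -> S} => (f y)@_(U_(j) + a)) ec.
rewrite !ffunE mcoeff0 raddf_sum (bigD1 x) //= eal -scalerAr mcoeffZ mcoeffMX.
rewrite big1 ?addr0 => [/eqP|z nez]; first by rewrite mulf_eq0 (negPf al0) (negPf ca).
have [->|cz] := eqVneq (c z) 0; first by rewrite mul0r mcoeff0.
have [->|dz] := eqVneq (delta z y) 0; first by rewrite mulr0 mcoeff0.
have mz : (wt (top z) <= wt (top x))%N := max z cz.
have [[tz sub]|] := delta_tri dz; last by rewrite ty ltnNge mz.
have [l ly dl] := lower_dirs sub.
have [be be0 ->] := delta_koszul (esym tz) ly dl.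
rewrite -scalerAr mcoeffZ; apply/eqP; rewrite mulf_eq0 (negPf be0) /=.
apply: contraT => /mcoeff_mulX_neq0[a' ea]; rewrite nl ?eqxx // /liftable.
have -> : pivot z a' = Some j.
  rewrite -E /pivot (open_dirs_shift _ (esym tz) dl) (open_dirs_shift _ (esym ty) dx).
  by rewrite -ea addmC.
rewrite dl !inE (negPf jy) orbF; apply: contra nez => /eqP ejl.
by apply/eqP; apply: cell_inj; rewrite -?tz -?ty // dl dx ejl.
Qed.

Lemma weight_bound i : exists W, forall x : B i, (wt (top x) < W)%N.
Proof.
by exists (\max_(x : B i) wt (top x)).+1 => x; rewrite ltnS (leq_bigmax x).
Qed.

(** The basis elements with a given top v span, in the graded pieces of the
    filtration by the weight of the top, a Koszul complex on the variables
    admissible for v.  The strand of such a complex in multidegree b is exact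
    unless v j = b j for all admissible j; the hypothesis [unique_critical] says
    that this happens for one v only, which leaves one generator of the image of
    the augmentation in each multidegree. *)
Theorem koszul_filtration_resolution (M : S -> Prop) :
  (forall q, M q <-> exists c, q = augment eps c) ->
  free_resolution delta eps M.
Proof.
move=> hM; split=> // [c|i c]; split=> [ec|[b ->]]; rewrite ?eps_delta ?delta_delta //.
  have [W hW] := weight_bound 0.
  have [b hb] := kill_liftable (fun x a (_ : liftable x a) (_ : (c x)@_a != 0) => hW x).
  exists b; apply/eqP; rewrite -subr_eq0; apply/eqP; apply: unliftable_cycle0 hb _.
  by rewrite augmentB ec eps_delta subrr.
have [W hW] := weight_bound i.+1.
have [b hb] := kill_liftable (fun x a (_ : liftable x a) (_ : (c x)@_a != 0) => hW x).
exists b; apply/eqP; rewrite -subr_eq0; apply/eqP; apply: unliftable_cycle hb _.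
by rewrite free_mapB ec delta_delta subrr.
Qed.

End KoszulFiltration.

(** * Profiles and cells *)

Section Cyclic.
Variable n' : nat.
Local Notation n := n'.+1.
Local Notation s := (@ordS n).

Lemma iter_ordS r (i : 'I_n) : val (iter r s i) = ((i + r) %% n)%N.
Proof.
elim: r => [|r /= ->]; first by rewrite addn0 modn_small.
by rewrite -addn1 modnDml addn1 addnS.
Qed.

Lemma ordS_reach (i j : 'I_n) : exists r, iter r s i = j.
Proof.
exists (j + n - i)%N; apply: val_inj; rewrite iter_ordS addnC subnK.
  by rewrite modnDr modn_small.
by rewrite (leq_trans (ltnW (ltn_ord i))) // leq_addl.
Qed.

Lemma cyclic_ind (P : 'I_n -> Prop) i : P i -> (forall j, P j -> P (s j)) ->
  forall j, P j.
Proof. by move=> hi hS j; have [r <-] := ordS_reach i j; elim: r => //= r /hS. Qed.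

Lemma cyclic_ind_back (P : 'I_n -> Prop) i : P i ->
  (forall j, P (s j) -> P j) -> forall j, P j.
Proof.
move=> hi hS j; have [r er] := ordS_reach j i.
elim: r j er => [j /= -> //|r IH j]; rewrite iterSr => /IH; exact: hS.
Qed.

Section Profile.
Variable m : 'X_{1..n}.
Local Notation d := (mdeg m).
Implicit Types (u v f : 'X_{1..n}) (c i j : 'I_n) (sg : {set 'I_n}).

(** Shifted by a constant that makes it a natural number, the difference of the
    partial sums of u and m in front of the position c. *)
Definition level u c : nat := (\sum_(j < n) if (j < c)%N then u j else m j)%N.

Lemma level_rec u c : mdeg u = d -> (level u (s c) + m c = level u c + u c)%N.
Proof.
move=> du; rewrite /level (bigD1 c) //= [X in (_ = X + _)%N](bigD1 c) //= ltnn.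
have [lt|ge] := ltnP c.+1 n.
  rewrite modn_small // ltnSn addnAC [RHS]addnAC [(u c + m c)%N]addnC.
  congr addn; apply: eq_bigr => j jc.
  by rewrite ltnS leq_eqVlt (inj_eq val_inj) (negPf jc).
have ec : c.+1 = n by apply/eqP; rewrite eqn_leq ge ltn_ord.
have eu : (\sum_(j < n | j != c) (if j < c then u j else m j) = \sum_(j < n | j != c) u j)%N.
  by apply: eq_bigr => j jc; rewrite ltn_neqAle jc -ltnS ec ltn_ord.
rewrite ec modnn ltn0 eu (eq_bigr (fun j => m j)) // addnAC [RHS]addnAC.
move: du; rewrite !mdegE (bigD1 c) //= [in RHS](bigD1 c) //= => e.
by rewrite -addnA -e addnA.
Qed.

(** Seen on a circle, the differences of partial sums are only defined up to an
    additive constant; the profile is the representative with minimum 0. *)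
Definition profile u c : nat := (level u c - level u [arg min_(j < ord0) level u j])%N.
Local Notation K := profile.

Lemma level_profile u i c : K u i = 0%N -> level u c = (K u c + level u i)%N.
Proof.
rewrite /K; case: arg_minnP => // j _ h.
by have := h i isT; have := h c isT; lia.
Qed.

Lemma profile_zero u : exists i, K u i = 0%N.
Proof. by exists [arg min_(j < ord0) level u j]; rewrite /K subnn. Qed.

Lemma profile_rec u c : mdeg u = d -> (K u (s c) + m c = K u c + u c)%N.
Proof.
have [i hi] := profile_zero u.
move=> /(level_rec c); rewrite (level_profile c hi) (level_profile (s c) hi).
by lia.
Qed.

Lemma profile_uniq u (k : 'I_n -> nat) : mdeg u = d ->
  (forall c, k (s c) + m c = k c + u c)%N -> (exists i, k i = 0%N) ->
  forall c, K u c = k c.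
Proof.
move=> du hk [i ki]; have E : forall c, (k c + K u i = K u c)%N.
  apply: (cyclic_ind (i := i)) => [|c]; first by rewrite ki.
  by have := hk c; have := profile_rec c du; lia.
have [j Kj] := profile_zero u; move=> c.
by have := E j; have := E c; lia.
Qed.

Lemma profile_inj u v : mdeg u = d -> mdeg v = d -> K u =1 K v -> u = v.
Proof.
move=> du dv e; apply/mnmP => c.
by have := profile_rec c du; have := profile_rec c dv; rewrite !e; lia.
Qed.

Definition of_profile (k : 'I_n -> nat) : 'X_{1..n} :=
  [multinom (k (s c) + m c - k c)%N | c < n].

Lemma of_profileP (k : 'I_n -> nat) :
  (forall c, k c <= k (s c) + m c)%N -> (exists i, k i = 0%N) ->
  [/\ mdeg (of_profile k) = d,
      forall c, (of_profile k c + k c = k (s c) + m c)%N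
    & forall c, K (of_profile k) c = k c].
Proof.
move=> hk k0; have E c : (of_profile k c + k c = k (s c) + m c)%N by rewrite mnmE subnK.
have dk : mdeg (of_profile k) = d.
  apply/eqP; rewrite -(eqn_add2r (\sum_c k c)) !mdegE -!big_split /=.
  rewrite (eq_bigr _ (fun c _ => E c)) !big_split /= addnC; apply/eqP; congr addn.
  by rewrite [RHS](reindex_inj (@ordS_inj n)).
split=> //; apply: profile_uniq => // c; have := E c; lia.
Qed.

(** Read backwards around the circle, the profile of v is the length of a queue
    with arrivals m and services v.  If v serves at full capacity b whenever
    there is a queue, no other schedule within the capacities has a shorter
    queue anywhere; start the comparison at a position where the queue is
    empty. *)
Lemma saturated_le (v w b : 'X_{1..n}) : mdeg v = d -> mdeg w = d ->
  (w <= b)%MM -> (forall c, 0 < K v c -> v c = b c)%N ->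
  forall c, (K v c <= K w c)%N.
Proof.
move=> dv dw /mnm_lepP wb hv; have [i hi] := profile_zero v.
apply: (cyclic_ind_back (i := i)) => [|c hc]; first by rewrite hi.
case: (posnP (K v c)) => [->//|/hv ev].
by have := profile_rec c dv; have := profile_rec c dw; have := wb c; lia.
Qed.

Lemma saturated_uniq (v w b : 'X_{1..n}) : mdeg v = d -> mdeg w = d ->
  (v <= b)%MM -> (w <= b)%MM -> (forall c, 0 < K v c -> v c = b c)%N ->
  (forall c, 0 < K w c -> w c = b c)%N -> v = w.
Proof.
move=> dv dw vb wb hv hw; apply: profile_inj => // c.
by apply/eqP; rewrite eqn_leq !(saturated_le (b := b)).
Qed.

(** The vertices of a cell arise from its top vertex v by moving letters of v
    forward along the circle, at most to the next letter and into positions in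
    sg or staying put, and at most one of the letters at each position.  Moving
    a letter from a to c lowers the profile by 1 on the positions after a up to
    c.  This is the list of local conditions describing such u: off sg, an empty
    position stays empty and a letter does not arrive at an occupied one. *)
Definition in_cell v sg u : bool :=
  (mdeg u == d) && [forall c, (K u c <= K v c <= (K u c).+1)%N &&
     ((c \in sg) || (if v c == 0%N then u c == 0%N else K u c == K v c))].

Lemma in_cellP v sg u : reflect
  [/\ mdeg u = d, forall c, (K u c <= K v c <= (K u c).+1)%N,
      forall c, c \notin sg -> v c = 0%N -> u c = 0%N
    & forall c, c \notin sg -> (0 < v c)%N -> K u c = K v c]
  (in_cell v sg u).
Proof.
apply: (iffP andP) => [[/eqP du /forallP h]|[du h1 h2 h3]].
  split=> // [c|c csg v0|c csg v0]; have /andP[] := h c => //.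
    by rewrite (negPf csg) v0 eqxx /= => _ /eqP.
  by rewrite (negPf csg) gtn_eqF //= => _ /eqP.
split; first exact/eqP; apply/forallP => c; rewrite h1 /=.
case: (boolP (c \in sg)) => //= csg; case: eqP => [/h2 -> //|/eqP v0].
by rewrite h3 // lt0n.
Qed.

Definition cell v sg : {fset 'X_{1..n}} :=
  [fset val u | u in [pred u : 'X_{1..n < d.+1} | in_cell v sg (val u)]].

Lemma mem_cell v sg u : (u \in cell v sg) = in_cell v sg u.
Proof.
apply/imfsetP/idP => [[w /= hw -> //]|h].
have du : (mdeg u < d.+1)%N by have /in_cellP[->] := h.
by exists (BMultinom du).
Qed.

(** A move of a letter into position c lowers the profile at c, where it must
    stay nonnegative. *)
Definition adm v : {set 'I_n} := [set c | (0 < K v c)%N].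

Lemma top_in_cell v sg : mdeg v = d -> in_cell v sg v.
Proof. by move=> dv; apply/in_cellP; split=> // c; rewrite leqnn leqnSn. Qed.

Lemma cell_mono v sg sg' : sg \subset sg' -> cell v sg `<=` cell v sg'.
Proof.
move=> sub; apply/fsubsetP => u; rewrite !mem_cell => /in_cellP[du h1 h2 h3].
by apply/in_cellP; split=> // c; move/(contra (subsetP sub c)); [apply: h2 | apply: h3].
Qed.

Lemma cell0 v : mdeg v = d -> cell v set0 = [fset v].
Proof.
move=> dv; apply/fsetP => u; rewrite mem_cell inE.
apply/idP/eqP => [|->]; last exact: top_in_cell.
move=> /in_cellP[du h1 h2 h3]; apply: profile_inj => //.
have [i hi] := profile_zero v; apply: (cyclic_ind_back (i := i)) => [|c hc].
  by have := h1 i; lia.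
case: (posnP (v c)) => [v0|v0]; last by apply: h3; rewrite ?inE.
have u0 := h2 c; rewrite inE in u0.
by have := profile_rec c du; have := profile_rec c dv; rewrite u0 // hc; lia.
Qed.

Definition step v : rel 'I_n := [rel x y | (v x == 0%N) && (y == s x)].
(** The positions between the last letter of v in front of c and c itself,
    c included: those where the profile drops when this letter moves to c. *)
Definition run v c j : bool := connect (step v) j c.

Lemma run_self v c : run v c c. Proof. exact: connect0. Qed.

Lemma run_ind v c (P : 'I_n -> Prop) : P c ->
  (forall j, run v c (s j) -> v j = 0%N -> P (s j) -> P j) ->
  forall j, run v c j -> P j.
Proof.
move=> Pc PS j /connectP[p].
elim: p j => [j _ /= <- //|x p IH j /= /andP[/andP[/eqP vj /eqP ex]] hp lp].
have Px := IH x hp lp; rewrite ex in Px hp lp; apply: PS => //.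
by apply/connectP; exists p.
Qed.

Lemma run_step v c j : run v c j -> j != c -> v j = 0%N /\ run v c (s j).
Proof.
move=> rj; apply: (run_ind (P := fun j => j != c -> v j = 0%N /\ run v c (s j))) rj => //.
by rewrite eqxx.
Qed.

Lemma run_back v c j : run v c (s j) -> v j = 0%N -> run v c j.
Proof.
by move=> rj vj; apply: connect_trans rj; apply: connect1; rewrite /step /= vj !eqxx.
Qed.

Lemma run_leave v c j : (run v c j <= run v c (s j) + (j == c))%N.
Proof.
case: (eqVneq j c) => [_|jc]; first by apply: leq_trans (leq_b1 _) _; rewrite addn1.
by case: (boolP (run v c j)) => // /run_step /(_ jc) [_ ->].
Qed.

Lemma run_idle v c j : j != c -> v j = 0%N -> run v c j = run v c (s j).
Proof.
by move=> jc vj; apply/idP/idP => [/run_step /(_ jc) []//|/run_back]; apply.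
Qed.

Lemma run_support v c j : j != c -> (0 < v j)%N -> run v c j = false.
Proof. by move=> jc vj; apply/negP => /run_step /(_ jc) [v0 _]; rewrite v0 in vj. Qed.

Section Run.
Variables (v : 'X_{1..n}) (c : 'I_n).
Hypotheses (dv : mdeg v = d) (Kc : (0 < K v c)%N).

(** Going backwards without passing a letter of v, the profile can only
    increase. *)
Lemma run_pos j : run v c j -> (0 < K v j)%N.
Proof.
apply: (run_ind (P := fun j => (0 < K v j)%N)) => // {}j _ vj h.
by have := profile_rec j dv; lia.
Qed.

(** Otherwise the run would wrap around the whole circle, including a zero of
    the profile. *)
Lemma run_end : ~~ run v c (s c).
Proof.
apply/negP => rc; have [i hi] := profile_zero v.
have all : forall j, run v c j.
  apply: (cyclic_ind (i := c)) => [|j rj]; first exact: run_self.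
  by case: (eqVneq j c) => [-> //|/(run_step rj)[]].
by have := run_pos (all i); rewrite hi.
Qed.

Lemma run_le_profile j : (run v c j <= K v j)%N.
Proof. by have := @run_pos j; case: (run v c j) => // /(_ isT). Qed.

Lemma run_enter j : (run v c (s j) <= run v c j + v j)%N.
Proof.
case: (posnP (v j)) => [vj|vj]; last first.
  by apply: leq_trans (leq_b1 _) _; rewrite addn_gt0 vj orbT.
by have := @run_back v c j; case: (run v c (s j)) => // /(_ isT vj) ->.
Qed.

(** The other end of the edge of X that starts at the vertex v and has the single
    direction c: the letter in front of c has moved to c. *)
Definition flip : 'X_{1..n} := of_profile (fun j => (K v j - run v c j)%N).

Lemma flipP : [/\ mdeg flip = d,
    forall j, (flip j + run v c (s j) = v j + run v c j)%N
  & forall j, (K flip j + run v c j = K v j)%N].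
Proof.
have [i hi] := profile_zero v.
have [||df E1 E2] := @of_profileP (fun j => (K v j - run v c j)%N).
- move=> j; have := profile_rec j dv.
  by have := run_enter j; have := run_le_profile (s j); lia.
- by exists i; rewrite hi.
rewrite /= in E1 E2; split=> // j; last by rewrite E2 subnK ?run_le_profile.
have := E1 j; rewrite -/flip; have := profile_rec j dv.
by have := run_le_profile j; have := run_le_profile (s j); lia.
Qed.

End Run.

Lemma flip_in_cell v sg c : mdeg v = d -> sg \subset adm v -> c \in sg ->
  in_cell v sg (flip v c).
Proof.
move=> dv adm_sg csg; have Kc : (0 < K v c)%N by have := subsetP adm_sg c csg; rewrite inE.
have [df ef Kf] := flipP dv Kc; apply/in_cellP; split=> // [j|j jsg vj|j jsg vj].
- by have := Kf j; have := leq_b1 (run v c j); lia.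
- have jc : j != c by apply: contraNneq jsg => ->.
  by have := ef j; have := run_idle jc vj; lia.
have jc : j != c by apply: contraNneq jsg => ->.
by have := Kf j; rewrite run_support // addn0.
Qed.

(** Whether some letter has moved into position c on the way from v to u. *)
Definition uses v c u : bool := if v c == 0%N then (0 < u c)%N else (K u c < K v c)%N.

(** One kind of facet: no letter moves to c. *)
Lemma cell_remove v sg c u : c \in sg ->
  in_cell v (sg :\ c) u = in_cell v sg u && ~~ uses v c u.
Proof.
move=> csg; apply/in_cellP/andP => [[du h1 h2 h3]|[/in_cellP[du h1 h2 h3] nu]].
  split; first apply/in_cellP; try split=> //.
  - by move=> j jsg; apply: h2; rewrite !inE negb_and jsg orbT.
  - by move=> j jsg; apply: h3; rewrite !inE negb_and jsg orbT.
  rewrite /uses; case: ifP => [/eqP v0|/negbT]; first by rewrite h2 // !inE eqxx.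
  by rewrite -lt0n => v0; rewrite h3 ?ltnn // !inE eqxx.
move: nu; rewrite /uses => nu.
split=> // j; rewrite !inE negb_and negbK => /orP[/eqP ->|jsg] vj.
- by move: nu; rewrite vj eqxx; lia.
- exact: h2.
- by move: nu; rewrite gtn_eqF //; have := h1 c; lia.
exact: h3.
Qed.

Lemma uses_lt v sg c u : mdeg v = d -> in_cell v sg u -> uses v c u ->
  (K u c < K v c)%N.
Proof.
move=> dv /in_cellP[du h1 _ _]; rewrite /uses.
have := h1 c; have := h1 (s c); have := profile_rec c du; have := profile_rec c dv.
by case: eqP => [->|_]; lia.
Qed.

Lemma used_run v sg c u : mdeg v = d -> in_cell v sg u -> (K u c < K v c)%N ->
  forall j, run v c j -> K v j = (K u j).+1.
Proof.
move=> dv /in_cellP[du h1 _ _] uc.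
apply: (run_ind (P := fun j => K v j = (K u j).+1)); first by have := h1 c; lia.
move=> j _ vj hj; have := h1 j; have := profile_rec j du; have := profile_rec j dv.
by rewrite vj; lia.
Qed.

(** Undoing the move into c replaces u by u' = u + v - flip v c, which raises the
    profile on the run of c. *)
Lemma move_back v sg c u : mdeg v = d -> sg \subset adm v -> c \in sg ->
  in_cell v sg u -> uses v c u ->
  exists u', [/\ in_cell v sg u', (u + v = u' + flip v c)%MM
    & (\sum_j K u j < \sum_j K u' j)%N].
Proof.
move=> dv adm_sg csg hu uc.
have Kc : (0 < K v c)%N by have := subsetP adm_sg c csg; rewrite inE.
have [df ef Kf] := flipP dv Kc; have [du h1 h2 h3] := in_cellP _ _ _ hu.
have [i hi] := profile_zero v.
have hr j : (run v c j <= K v j - K u j)%N.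
  have := @used_run v sg c u dv hu (uses_lt dv hu uc) j.
  by case: (run v c j) => // /(_ isT); lia.
have uc_gt0 : (0 < u c)%N.
  move: uc; rewrite /uses; have := profile_rec c du; have := profile_rec c dv.
  by have := h1 (s c); case: eqP => [_|]; lia.
have [||du' E1 E2] := @of_profileP (fun j => (K u j + run v c j)%N).
- move=> j; have := profile_rec j du; have := run_leave v c j.
  by have := leq_b1 (run v c j); case: (eqVneq j c) => [->|_]; lia.
- by exists i; have := h1 i; have := hr i; rewrite hi; lia.
set u' := of_profile _ in du' E1 E2; rewrite /= in E1 E2; exists u'; split.
- apply/in_cellP; split=> // [j|j jsg vj|j jsg vj]; rewrite ?E2.
  + by have := h1 j; have := hr j; lia.
  + have jc : j != c by apply: contraNneq jsg => ->.
    have := E1 j; have := profile_rec j du; have := h2 j jsg vj.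
    by have := run_idle jc vj; lia.
  have jc : j != c by apply: contraNneq jsg => ->.
  by rewrite run_support // addn0 h3.
- apply/mnmP => j; rewrite !mnmDE; have := ef j; have := E1 j.
  by have := profile_rec j du; lia.
rewrite (eq_bigr _ (fun j _ => E2 j)) big_split /= -[X in (X < _)%N]addn0 ltn_add2l.
by rewrite (bigD1 c) //= run_self.
Qed.

(** If no letter of the run of c has moved, then the letter in front of c can move
    to c. *)
Lemma move_into v sg c u : mdeg v = d -> sg \subset adm v -> c \in sg ->
  in_cell v sg u -> (forall j, run v c j -> K u j = K v j) ->
  exists2 u', in_cell v sg u' & (u' + v = u + flip v c)%MM.
Proof.
move=> dv adm_sg csg hu hr.
have Kc : (0 < K v c)%N by have := subsetP adm_sg c csg; rewrite inE.
have [df ef Kf] := flipP dv Kc; have [du h1 h2 h3] := in_cellP _ _ _ hu.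
have [i hi] := profile_zero v; have rp := run_le_profile dv Kc.
have hr' j : (run v c j + K v j <= K u j + 1)%N.
  by have := h1 j; have := hr j; case: (run v c j) => [/(_ isT)|_]; lia.
have rpu j : (run v c j <= K u j)%N.
  by have := rp j; have := hr j; case: (run v c j) => // /(_ isT) ->.
have [||du' E1 E2] := @of_profileP (fun j => (K u j - run v c j)%N).
- move=> j; have := profile_rec j du; have := profile_rec j dv.
  have := run_enter v c j; have := hr' j; have := hr' (s j).
  have := rpu j; have := rpu (s j); have := h1 j; have := h1 (s j).
  by case: (run v c j) (run v c (s j)) => [] [] /=; lia.
- by exists i; have := h1 i; rewrite hi; lia.
set u' := of_profile _ in du' E1 E2; rewrite /= in E1 E2; exists u'; last first.
  apply/mnmP => j; rewrite !mnmDE; have := ef j; have := E1 j.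
  by have := profile_rec j du; have := rpu j; have := rpu (s j); lia.
apply/in_cellP; split=> // [j|j jsg vj|j jsg vj]; rewrite ?E2.
- by have := h1 j; have := hr' j; have := rpu j; have := leq_b1 (run v c j); lia.
- have jc : j != c by apply: contraNneq jsg => ->.
  have := E1 j; have := profile_rec j du; have := h2 j jsg vj.
  by have := run_idle jc vj; have := rpu j; have := rpu (s j); lia.
have jc : j != c by apply: contraNneq jsg => ->.
by rewrite run_support // subn0 h3.
Qed.

(** Of all positions in sg to which a given letter of v may move, c is the
    first. *)
Definition leading v sg c : Prop := forall j, run v c j -> j \in sg -> j = c.

(** The other kind of facet: the letter in front of c does not stay at its place.
    The cell is a product of simplices, one for each letter; this facet removes
    from one factor its first vertex, which makes c the new place of the
    letter. *)
Lemma cell_flip v sg c u : mdeg v = d -> sg \subset adm v -> c \in sg ->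
  leading v sg c ->
  in_cell (flip v c) (sg :\ c) u = in_cell v sg u && (K u c < K v c)%N.
Proof.
move=> dv adm_sg csg lead.
have Kc : (0 < K v c)%N by have := subsetP adm_sg c csg; rewrite inE.
have [df ef Kf] := flipP dv Kc; have nend := negbTE (run_end dv Kc).
have fc : flip v c c = (v c).+1 by have := ef c; rewrite run_self nend; lia.
have out j : j \notin sg -> j \notin sg :\ c by rewrite !inE negb_and => ->; rewrite orbT.
apply/idP/andP => [/in_cellP[du h1 h2 h3]|[hu uc]].
  have ec : K u c = K (flip v c) c by rewrite h3 ?fc // !inE eqxx.
  have er : forall j, run v c j -> K u j = K (flip v c) j.
    apply: (run_ind (P := fun j => K u j = K (flip v c) j)) => // j rj vj ej.
    case: (eqVneq j c) => [-> //|jc].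
    have jsg : j \notin sg by apply: contra jc => /(lead j (run_back rj vj)) ->.
    have fj : flip v c j = 0%N by have := ef j; have := run_idle jc vj; lia.
    have := profile_rec j du; have := profile_rec j df.
    by rewrite fj (h2 j (out j jsg) fj) ej; lia.
  split; last by rewrite ec; have := Kf c; rewrite run_self; lia.
  apply/in_cellP; split=> // [j|j jsg vj|j jsg vj].
  - have := h1 j; have := Kf j; have := er j.
    by case: (run v c j) => [/(_ isT)|_] /=; lia.
  - have jc : j != c by apply: contraNneq jsg => ->.
    apply: h2; first exact: out.
    by have := ef j; have := run_idle jc vj; lia.
  have jc : j != c by apply: contraNneq jsg => ->.
  have := Kf j; rewrite (run_support jc vj) addn0 => <-.
  case: (posnP (flip v c j)) => [fj|]; last by apply: h3; apply: out.
  have rj : run v c (s j) by have := ef j; rewrite fj; case: (run v c (s j)) => //=; lia.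
  have := profile_rec j du; have := profile_rec j df.
  by rewrite fj (h2 j (out j jsg) fj) (er _ rj); lia.
have [du h1 h2 h3] := in_cellP _ _ _ hu; have er := used_run dv hu uc.
apply/in_cellP; split=> // [j|j|j].
- have := h1 j; have := Kf j; have := er j.
  by case: (run v c j) => [/(_ isT)|_] /=; lia.
- rewrite !inE negb_and negbK => /orP[/eqP ->|jsg] fj; first by rewrite fj in fc.
  have jc : j != c by apply: contraNneq jsg => ->.
  case: (posnP (v j)) => [|vj]; first exact: h2.
  have := ef j; rewrite fj (run_support jc vj) addn0 add0n => vr.
  have rj : run v c (s j) by move: vj; rewrite -vr; case: (run v c (s j)).
  have := profile_rec j du; have := profile_rec j dv.
  by have := er _ rj; rewrite (h3 j jsg vj) -vr rj /=; lia.
rewrite !inE negb_and negbK => /orP[/eqP ->|jsg] fj.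
  by have := Kf c; have := er c; rewrite run_self => /(_ isT); lia.
have jc : j != c by apply: contraNneq jsg => ->.
case: (posnP (v j)) => [vj|vj].
  by move: fj; have := ef j; have := run_idle jc vj; lia.
by have := Kf j; rewrite (run_support jc vj) addn0 (h3 j jsg vj).
Qed.

Lemma flip_adm v sg c : mdeg v = d -> sg \subset adm v -> c \in sg ->
  leading v sg c -> sg :\ c \subset adm (flip v c).
Proof.
move=> dv adm_sg csg lead.
have Kc : (0 < K v c)%N by have := subsetP adm_sg c csg; rewrite inE.
have [df ef Kf] := flipP dv Kc.
apply/subsetP => j; rewrite !inE => /andP[jc jsg].
have := subsetP adm_sg j jsg; rewrite inE -(Kf j).
have : ~~ run v c j by apply: contra jc => rj; apply/eqP/lead.
by case: (run v c j); rewrite //= addn0.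
Qed.

Lemma run_last v j c : run v (s j) c -> c != s j -> run v j c.
Proof.
apply: (run_ind (P := fun x => x != s j -> run v j x)); first by rewrite eqxx.
move=> x rx vx IH _; case: (eqVneq (s x) (s j)) => [/ordS_inj ->|]; first exact: run_self.
by move=> /IH/run_back; apply.
Qed.

Lemma run_total v c i j : run v c i -> run v c j -> run v i j || run v j i.
Proof.
move=> ri; apply: (run_ind (P := fun x => run v i x || run v x i)) => [|x rx vx].
  by rewrite ri orbT.
case/orP => [h|h]; first by rewrite run_back.
case: (eqVneq i (s x)) => [ei|ne]; first by rewrite ei run_back // run_self.
by apply/orP; right; exact: run_last.
Qed.

(** A letter that has not moved up to its first possible target has not moved
    at all. *)
Lemma leading_idle v sg c i u : mdeg v = d -> in_cell v sg u ->
  leading v sg i -> run v c i -> K u i = K v i ->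
  forall j, run v c j -> K u j = K v j.
Proof.
move=> dv /in_cellP[du h1 h2 h3] lead ri ei j rj.
have /orP[r|r] := run_total ri rj.
  move: r; apply: (run_ind (P := fun x => K u x = K v x)) => // x rx vx ex.
  case: (boolP (x \in sg)) => [/(lead x (run_back rx vx)) -> //|xsg].
  have := profile_rec x du; have := profile_rec x dv.
  by rewrite (h2 x xsg vx) vx ex; lia.
suff prop x : run v j x -> K u x = K v x -> K u j = K v j by exact: prop r ei.
apply: (run_ind (P := fun x => K u x = K v x -> K u j = K v j)) => // {}x rx vx IH ex.
apply: IH; have := profile_rec x du; have := profile_rec x dv.
by have := h1 (s x); rewrite vx ex; lia.
Qed.

Lemma leading_exists v sg c : mdeg v = d -> sg \subset adm v -> c \in sg ->
  exists i, [/\ i \in sg, run v c i & leading v sg i].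
Proof.
move=> dv adm_sg csg.
pose p := [pred i | (i \in sg) && run v c i].
have pc : p c by rewrite /= csg run_self.
case: (@arg_minnP _ c p (fun i => #|[set j | run v i j]|) pc) => i /andP[isg ri] min.
exists i; split=> // j rj jsg; apply/eqP; apply: contraT => ji.
have pj : p j by rewrite /= jsg; exact: connect_trans rj ri.
have := min _ pj; rewrite leqNgt => /negP; case; apply: proper_card.
apply/properP; split.
  by apply/subsetP => x; rewrite !inE => rx; apply: connect_trans rx rj.
exists i; rewrite !inE ?run_self //; apply/negP => rij.
have Ki : (0 < K v i)%N by have := subsetP adm_sg i isg; rewrite inE.
rewrite eq_sym in ji; have [_ r1] := run_step rij ji.
by have /negP := run_end dv Ki; apply; apply: connect_trans r1 rj.
Qed.

Lemma cell_idle v sg u : mdeg v = d -> in_cell v sg u ->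
  (forall c, c \in sg -> ~~ uses v c u) -> u = v.
Proof.
move=> dv /in_cellP[du h1 h2 h3] nu.
apply/eqP; have : u \in cell v set0; last by rewrite cell0 // inE.
rewrite mem_cell; apply/in_cellP; split=> // c _ vc.
  case: (boolP (c \in sg)) => [/nu|/h2]; last exact.
  by rewrite /uses vc eqxx; lia.
case: (boolP (c \in sg)) => [/nu|/h3]; last exact.
by rewrite /uses gtn_eqF //; have := h1 c; lia.
Qed.

Section Faces.
Variable R : realFieldType.
Local Notation pos := (@exponent_vector n R).

Lemma posD u v : pos (u + v)%MM = pos u + pos v.
Proof. by apply/rowP => j; rewrite !mxE mnmDE natrD. Qed.

Lemma exchange_value (w : 'rV[R]_n) u u' v v' : (u + v = u' + v')%MM ->
  dotmul w (pos u) + dotmul w (pos v) = dotmul w (pos u') + dotmul w (pos v').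
Proof. by move=> e; rewrite -!dotmulDr -!posD e. Qed.

(** A linear functional w changes by om c when a letter moves to c.  Where it is
    maximal no letter makes a move with om c < 0, which confines the face to
    [cell_remove], and no letter stays put if it has a move with om c > 0, which
    confines it to [cell_flip].  If om vanishes on sg, then w is constant. *)
Lemma cell_face v sg G : mdeg v = d -> sg \subset adm v ->
  is_face pos G (cell v sg) -> G != fset0 ->
  exists v' sg', [/\ mdeg v' = d, sg' \subset adm v' & G = cell v' sg'].
Proof.
elim/ltn_ind: {sg}#|sg| {-2}sg v (erefl #|sg|) => N IH sg v eN dv adm_sg fG G0.
have [w [b [hF eG]]] := fG.
have GF := face_fsub fG.
have Gb u : u \in G -> dotmul w (pos u) = b by rewrite eG !inE => /andP[_ /eqP].
pose om c := dotmul w (pos (flip v c)) - dotmul w (pos v).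
case: (pickP [pred c | (c \in sg) && (om c < 0)]) => [c /andP[csg oc]|nneg].
  have sub : G `<=` cell v (sg :\ c).
    apply/fsubsetP => u uG; have := fsubsetP GF u uG.
    rewrite !mem_cell (cell_remove _ _ csg) => hu; rewrite hu /=; apply/negP => uc.
    have [u' [hu' e _]] := move_back dv adm_sg csg hu uc.
    have := exchange_value w e; have := hF u'; rewrite mem_cell (Gb u uG) => /(_ hu').
    by move: oc; rewrite /om; lra.
  apply: (IH _ _ (sg :\ c) v erefl dv _ _ G0).
  - by rewrite -eN [X in (_ < X)%N](cardsD1 c) csg.
  - by apply: subset_trans adm_sg; apply: subD1set.
  by apply: is_face_restrict fG sub _; apply: cell_mono; apply: subD1set.
case: (pickP [pred c | (c \in sg) && (0 < om c)]) => [c /andP[csg oc]|npos].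
  have [i [isg ri lead]] := leading_exists dv adm_sg csg.
  have cf := cell_flip _ dv adm_sg isg lead.
  have Ki : (0 < K v i)%N by have := subsetP adm_sg i isg; rewrite inE.
  have [df _ _] := flipP dv Ki.
  have sub : G `<=` cell (flip v i) (sg :\ i).
    apply/fsubsetP => u uG; have := fsubsetP GF u uG.
    rewrite !mem_cell cf => hu; rewrite hu /= ltnNge; apply/negP => ui.
    have [_ /(_ i) h1 _ _] := in_cellP _ _ _ hu.
    have ei : K u i = K v i by lia.
    have [u' hu' e] := move_into dv adm_sg csg hu (leading_idle dv hu lead ri ei).
    have := exchange_value w e; have := hF u'; rewrite mem_cell (Gb u uG) => /(_ hu').
    by move: oc; rewrite /om; lra.
  apply: (IH _ _ (sg :\ i) (flip v i) erefl df _ _ G0).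
  - by rewrite -eN [X in (_ < X)%N](cardsD1 i) isg.
  - exact: flip_adm.
  apply: is_face_restrict fG sub _; apply/fsubsetP => u.
  by rewrite !mem_cell cf => /andP[].
have om0 c : c \in sg -> dotmul w (pos (flip v c)) = dotmul w (pos v).
  move=> csg; have := nneg c; have := npos c; rewrite /= csg /= /om => /negbT h1 /negbT h2.
  by move: h1 h2; rewrite -!leNgt; lra.
have const u : in_cell v sg u -> dotmul w (pos u) = dotmul w (pos v).
  have bound u' : in_cell v sg u' -> (\sum_j K u' j <= \sum_j K v j)%N.
    by move=> /in_cellP[_ h1 _ _]; apply: leq_sum => j _; have := h1 j; lia.
  elim/ltn_ind: {u}(\sum_j K v j - \sum_j K u j)%N {-2}u
    (erefl (\sum_j K v j - \sum_j K u j)%N) => M IHM u eM hu.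
  case: (pickP [pred c | (c \in sg) && uses v c u]) => [c /andP[csg uc]|no].
    have [u' [hu' e lt]] := move_back dv adm_sg csg hu uc.
    have := exchange_value w e; rewrite (om0 c csg) => /addIr ->.
    have bu := bound _ hu'; apply: IHM (erefl _) hu'; rewrite -eM.
    by lia.
  rewrite (cell_idle dv hu) // => c csg.
  by have /negbT := no c; rewrite /= csg.
exists v, sg; split=> //; apply/eqP; rewrite eqEfsubset GF /=.
have /fset0Pn[u1 u1G] := G0.
have u1v : dotmul w (pos v) = b.
  by rewrite -(Gb u1 u1G) const // -mem_cell (fsubsetP GF).
by apply/fsubsetP => u uF; rewrite eG !inE uF /= const ?u1v // -mem_cell.
Qed.

End Faces.

End Profile.
End Cyclic.

(** * Convexity, labels and dimensions of cells *)

Section CellGeometry.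
Variables (n' : nat) (R : realFieldType).
Local Notation n := n'.+1.
Local Notation s := (@ordS n).
Variable m : 'X_{1..n}.
Local Notation d := (mdeg m).
Local Notation K := (profile m).
Local Notation adm := (adm m).
Local Notation cell := (cell m).
Local Notation pos := (@exponent_vector n R).
Implicit Types (u v : 'X_{1..n}) (c i j : 'I_n) (sg : {set 'I_n}).

Lemma level_diff u i c : (level m u c + K u i = level m u i + K u c)%N.
Proof.
have [j hj] := profile_zero m u.
by rewrite (level_profile c hj) (level_profile i hj); lia.
Qed.

Definition affine (f : 'X_{1..n} -> R) : Prop :=
  exists w b, forall u, f u = dotmul w (pos u) + b.

Lemma affine_coord j : affine (fun u => (u j)%:R).
Proof.
exists (\row_l (l == j)%:R), 0 => u; rewrite addr0 dotmulE (bigD1 j) //= big1.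
  by rewrite !mxE eqxx mul1r addr0.
by move=> l /negPf lj; rewrite !mxE lj mul0r.
Qed.

Lemma affine_cst b : affine (fun _ => b).
Proof. by exists 0, b => u; rewrite /dotmul mul0mx mxE add0r. Qed.

Lemma affineD f g : affine f -> affine g -> affine (fun u => f u + g u).
Proof.
move=> [w [b hf]] [w' [b' hg]]; exists (w + w'), (b + b') => u.
by rewrite hf hg dotmulDl; ring.
Qed.

Lemma affineZ a f : affine f -> affine (fun u => a * f u).
Proof.
by move=> [w [b hf]]; exists (a *: w), (a * b) => u; rewrite hf dotmulZl; ring.
Qed.

Lemma affine_sum (I : Type) (r : seq I) (P : pred I) (F : I -> 'X_{1..n} -> R) :
  (forall x, P x -> affine (F x)) -> affine (fun u => \sum_(x <- r | P x) F x u).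
Proof.
move=> hF; elim: r => [|x r IH].
  have [w [b e]] := affine_cst 0; exists w, b => u; by rewrite big_nil -e.
case: (boolP (P x)) => Px.
  have [w [b e]] := affineD (hF x Px) IH.
  by exists w, b => u; rewrite big_cons Px e.
by have [w [b e]] := IH; exists w, b => u; rewrite big_cons (negPf Px) e.
Qed.

Lemma affine_level c : affine (fun u => (level m u c)%:R).
Proof.
have hF (j : 'I_n) : true -> affine (fun u => (if (j < c)%N then u j else m j)%:R).
  by case: (j < c)%N => _; [apply: affine_coord | apply: affine_cst].
have [w [b e]] := affine_sum (index_enum 'I_n) hF.
by exists w, b => u; rewrite -e /level natr_sum.
Qed.

(** The distance at x between the square function and its chord through k - 1
    and k; [gap_fixed] is its distance to the tangent at k. *)
Definition gap_free x k := let e := ((x - k) + (k.-1 - x))%N in (e * e.+1)%N.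
Definition gap_fixed x k := let e := ((x - k) + (k - x))%N in (e * e)%N.

Lemma gap_freeE x k : (0 < k)%N ->
  (gap_free x k)%:R = x%:R ^+ 2 - (2 * k%:R - 1) * x%:R + k%:R * (k%:R - 1) :> R.
Proof.
case: k => // k _; rewrite /gap_free /=; case: (leqP k.+1 x) => [le|lt].
  have [a ->] : exists a, x = (k.+1 + a)%N by exists (x - k.+1)%N; rewrite subnKC.
  have -> : (k.+1 + a - k.+1 + (k - (k.+1 + a)))%N = a by lia.
  by rewrite !(natrM, natrD, mulrS); ring.
have [a ->] : exists a, k = (x + a)%N by exists (k - x)%N; rewrite subnKC.
have -> : (x - (x + a).+1 + (x + a - x))%N = a by lia.
by rewrite !(natrM, natrD, mulrS); ring.
Qed.

Lemma gap_fixedE x k :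
  (gap_fixed x k)%:R = x%:R ^+ 2 - 2 * k%:R * x%:R + k%:R ^+ 2 :> R.
Proof.
rewrite /gap_fixed; case: (leqP k x) => [le|/ltnW le].
  have [a ->] : exists a, x = (k + a)%N by exists (x - k)%N; rewrite subnKC.
  have -> : (k + a - k + (k - (k + a)))%N = a by lia.
  by rewrite !(natrM, natrD); ring.
have [a ->] : exists a, k = (x + a)%N by exists (k - x)%N; rewrite subnKC.
have -> : (x - (x + a) + (x + a - x))%N = a by lia.
by rewrite !(natrM, natrD); ring.
Qed.

Definition convex_height u : R := \sum_c (K u c)%:R ^+ 2.

(** Fix i with K v i = 0.  The affine function replaces each square in the height
    by its chord or its tangent at K v c, evaluated at the profile normalized to
    vanish at i, and subtracts the exponents u c that must vanish.  The profile
    normalized at i is at most K u, and equal to it exactly when K u i = 0; so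
    the height exceeds the affine function by a sum of terms of which each
    vanishes exactly when one of the conditions defining the cell holds. *)
Lemma cell_lower_face v sg : mdeg v = d -> sg \subset adm v ->
  lower_face pos (fun u => mdeg u = d) convex_height (cell v sg).
Proof.
move=> dv adm_sg; split=> [u|]; first by rewrite mem_cell => /in_cellP[].
have [i hi] := profile_zero m v.
pose free c := (0 < K v c)%N && ((c \in sg) || (v c == 0%N)).
pose z c : nat := (c \notin sg) && (v c == 0%N).
pose sl c : nat := if free c then ((K v c).*2.-1)%N else (K v c).*2.
pose cst c : R := if free c then (K v c)%:R * ((K v c)%:R - 1) else (K v c)%:R ^+ 2.
pose gap u c : nat := ((if free c then gap_free (K u c) (K v c) else gap_fixed (K u c) (K v c))
  + sl c * K u i + z c * u c)%N.
pose l u := \sum_c ((sl c)%:R * ((level m u c)%:R + -1 * (level m u i)%:R)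
   + (- cst c) + (- (z c)%:R) * (u c)%:R).
have [w [b hl]] : affine l.
  apply: affine_sum => c _; apply: affineD; last exact/affineZ/affine_coord.
  apply: affineD; last exact: affine_cst.
  apply: affineZ; apply: affineD; first exact: affine_level.
  exact/affineZ/affine_level.
have key u : convex_height u = l u + (\sum_c gap u c)%:R.
  rewrite natr_sum -big_split /=; apply: eq_bigr => c _.
  have e : (level m u c)%:R = (level m u i)%:R + (K u c)%:R - (K u i)%:R :> R.
    by rewrite -natrD -(level_diff u i c) natrD addrK.
  rewrite {}e; move: (level m u i)%:R => a.
  rewrite /gap !natrD !natrM /sl /cst; case: ifP => [/andP[k0 _]|_].
    rewrite gap_freeE //; have -> : ((K v c).*2.-1)%:R = 2 * (K v c)%:R - 1 :> R.
      by rewrite -subn1 natrB ?double_gt0 // -mul2n natrM.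
    by ring.
  by rewrite gap_fixedE -mul2n natrM; ring.
exists w, b => u du; rewrite -hl key; split; first by rewrite lerDl ler0n.
rewrite -[X in X == _]addr0 (inj_eq (addrI _)) eq_sym pnatr_eq0 sum_nat_eq0 mem_cell.
apply/forallP/in_cellP => [g0|[_ h1 h2 h3] c].
  have {}g0 c : gap u c = 0%N by apply/eqP; have := g0 c; rewrite implyTb.
  have Kui : K u i = 0%N.
    have := g0 i; rewrite /gap /free hi /= /gap_fixed subn0 sub0n addn0.
    by move/eqP; rewrite !addn_eq0 muln_eq0 orbb => /andP[/andP[/eqP]].
  have g1 c : (if free c then gap_free (K u c) (K v c) else gap_fixed (K u c) (K v c)) = 0%N.
    by move/eqP: (g0 c); rewrite /gap !addn_eq0 => /andP[/andP[/eqP]].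
  have g2 c : (z c * u c = 0)%N by move/eqP: (g0 c); rewrite /gap !addn_eq0 => /andP[_ /eqP].
  split=> // [c|c csg vc|c csg vc].
  - have := g1 c; rewrite /gap_free /gap_fixed; case: ifP => [/andP[k0 _]|_] /eqP.
      by rewrite muln_eq0 orbF; lia.
    by rewrite muln_eq0 orbb; lia.
  - by have := g2 c; rewrite /z csg vc /= mul1n.
  have := g1 c; rewrite /free (negPf csg) gtn_eqF //= andbF /gap_fixed => /eqP.
  by rewrite muln_eq0 orbb; lia.
rewrite implyTb /gap; have -> : K u i = 0%N by have := h1 i; lia.
have -> : (z c * u c = 0)%N.
  by rewrite /z; case: (boolP (c \in sg)) => //= csg; case: eqP => //= vc; rewrite h2.
rewrite muln0 !addn0 /free /gap_free /gap_fixed; have := h1 c; have := h3 c.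
case: (posnP (K v c)) => [->|k0] /=; first by rewrite muln_eq0 orbb; lia.
case: (boolP (c \in sg)) => csg /=; first by rewrite muln_eq0 orbF; lia.
case: (posnP (v c)) => vc; first by rewrite muln_eq0 orbF; lia.
by move=> /(_ isT isT) ->; rewrite muln_eq0 orbb; lia.
Qed.

Lemma cell_is_face v sg v' sg' : mdeg v = d -> sg \subset adm v ->
  mdeg v' = d -> sg' \subset adm v' -> cell v sg `<=` cell v' sg' ->
  is_face pos (cell v sg) (cell v' sg').
Proof. by move=> *; apply: lower_face_is_face; [apply: cell_lower_face..|]. Qed.

Lemma in_cell_le v sg u c : mdeg v = d -> in_cell m v sg u ->
  (u c <= v c + (c \in sg))%N.
Proof.
move=> dv /in_cellP[du h1 h2 h3]; have := profile_rec c du; have := profile_rec c dv.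
have := h1 c; have := h1 (s c); case: (boolP (c \in sg)) => csg /=; first lia.
by case: (posnP (v c)) => [/(h2 c csg)|/(h3 c csg)]; lia.
Qed.

Lemma flip_at v c : mdeg v = d -> (0 < K v c)%N -> flip m v c c = (v c).+1.
Proof.
move=> dv Kc; have [_ ef _] := flipP dv Kc; have := ef c.
by rewrite run_self (negbTE (run_end dv Kc)); lia.
Qed.

Lemma face_labelE (F : {fset 'X_{1..n}}) c :
  face_label id F c = (\max_(u <- F) u c)%N.
Proof.
rewrite /face_label; apply: (big_morph (fun u : 'X_{1..n} => u c)) => [u v|].
  by rewrite mnmE.
by rewrite mnm0E.
Qed.

Lemma cell_label v sg c : mdeg v = d -> sg \subset adm v ->
  face_label id (cell v sg) c = (v c + (c \in sg))%N.
Proof.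
move=> dv adm_sg; rewrite face_labelE; apply/eqP; rewrite eqn_leq; apply/andP; split.
  by apply/bigmax_leqP_seq => u hu _; apply: in_cell_le; rewrite -?mem_cell.
case: (boolP (c \in sg)) => csg; last first.
  rewrite addn0; apply: (leq_bigmax_seq (F := fun u : 'X_{1..n} => u c) v) => //.
  by rewrite mem_cell top_in_cell.
have Kc : (0 < K v c)%N by have := subsetP adm_sg c csg; rewrite inE.
rewrite addn1 -flip_at //.
apply: (leq_bigmax_seq (F := fun u : 'X_{1..n} => u c) (flip m v c)) => //.
by rewrite mem_cell flip_in_cell.
Qed.

Definition weight v : nat := (\sum_c K v c)%N.

(** The top vertex has the largest profile of the cell, so a cell inside another
    one has a lighter top or the same top. *)
Lemma cell_subset v sg v' sg' : mdeg v = d -> sg \subset adm v ->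
  mdeg v' = d -> cell v sg `<=` cell v' sg' ->
  (v = v' /\ sg \subset sg') \/ (weight v < weight v')%N.
Proof.
move=> dv adm_sg dv' sub.
have : in_cell m v' sg' v by rewrite -mem_cell (fsubsetP sub) // mem_cell top_in_cell.
move=> /in_cellP[_ h1 _ _].
have le c : (K v c <= K v' c)%N by have := h1 c; lia.
case: (ltnP (weight v) (weight v')) => [|ge]; [by right | left].
have ev : v = v'.
  apply: (profile_inj (m := m)) => // c; apply/eqP; rewrite eqn_leq le.
  rewrite leqNgt; apply/negP => lt; move: ge; rewrite leqNgt => /negP; apply.
  rewrite /weight (bigD1 c) //= [X in (_ < X)%N](bigD1 c) //=.
  by rewrite -addSn leq_add // leq_sum.
split=> //; apply/subsetP => c csg.
have Kc : (0 < K v c)%N by have := subsetP adm_sg c csg; rewrite inE.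
have : in_cell m v' sg' (flip m v c).
  by rewrite -mem_cell (fsubsetP sub) // mem_cell flip_in_cell.
move=> /(in_cell_le c dv'); rewrite flip_at // ev.
by case: (c \in sg') => //; rewrite addn0 ltnn.
Qed.

Lemma cell_injective v sg v' sg' : mdeg v = d -> sg \subset adm v ->
  mdeg v' = d -> sg' \subset adm v' -> cell v sg = cell v' sg' ->
  v = v' /\ sg = sg'.
Proof.
move=> dv a dv' a' e.
have s1 : cell v sg `<=` cell v' sg' by rewrite e fsubset_refl.
have s2 : cell v' sg' `<=` cell v sg by rewrite e fsubset_refl.
have [[ev b]|lt] := cell_subset dv a dv' s1; have [[ev' b']|lt'] := cell_subset dv' a' dv s2.
- by split=> //; apply/eqP; rewrite eqEsubset b b'.
- by rewrite ev ltnn in lt'.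
- by rewrite ev' ltnn in lt.
by have := ltn_trans lt lt'; rewrite ltnn.
Qed.

(** Removing the directions one at a time gives a chain of proper faces. *)
Lemma cell_dim_ge v sg : mdeg v = d -> sg \subset adm v ->
  (#|sg| <= dimf pos (cell v sg))%N.
Proof.
move=> dv; elim/ltn_ind: {sg}#|sg| {-2}sg (erefl #|sg|) => N IH sg eN adm_sg.
case: (set_0Vmem sg) => [e|[c csg]]; first by rewrite e cards0.
have eN' : N = #|sg :\ c|.+1 by rewrite -eN [LHS](cardsD1 c) csg.
have a' : sg :\ c \subset adm v by apply: subset_trans (subD1set _ _) adm_sg.
have lt : (#|sg :\ c| < N)%N by rewrite eN'.
rewrite eN eN'; apply: leq_ltn_trans (IH _ lt _ erefl a') _.
apply: face_dimf_lt.
- by apply: cell_is_face => //; apply: cell_mono; apply: subD1set.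
- by apply/fset0Pn; exists v; rewrite mem_cell top_in_cell.
apply/eqP => e; have [_ /setP/(_ c)] := cell_injective dv a' dv adm_sg e.
by rewrite !inE eqxx csg.
Qed.

(** A vector in the direction of the cell is determined by the differences of its
    partial sums at the positions in sg: off sg, they vanish or are inherited
    from the next position, and they vanish at a zero of the profile. *)
Lemma cell_dim_le v sg : mdeg v = d -> (dimf pos (cell v sg) <= #|sg|)%N.
Proof.
move=> dv; have [i hi] := profile_zero m v.
pose e c : 'rV[R]_n := \row_l (l == c)%:R.
pose h c : 'rV[R]_n := \row_l ((l < c)%:R - (l < i)%:R).
have de c x : dotmul (e c) x = x 0 c.
  rewrite dotmulE (bigD1 c) //= big1 => [|l /negPf lc]; last by rewrite mxE lc mul0r.
  by rewrite mxE eqxx mul1r addr0.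
have dh c : exists b, forall u, dotmul (h c) (pos u) = (K u c)%:R - (K u i)%:R + b.
  exists (\sum_(l < n) ((if (l < i)%N then 0 else (m l)%:R)
                        - (if (l < c)%N then 0 else (m l)%:R))) => u.
  have := congr1 (fun N => N%:R : R) (level_diff u i c); rewrite !natrD => e0.
  have -> : (K u c)%:R - (K u i)%:R = (level m u c)%:R - (level m u i)%:R :> R by lra.
  rewrite dotmulE /level !natr_sum -sumrB -big_split /=; apply: eq_bigr => l _.
  by rewrite !mxE; case: (l < c)%N; case: (l < i)%N; rewrite /=; ring.
have in0 u : in_cell m v sg u -> K u i = 0%N.
  by move=> /in_cellP[_ h1 _ _]; have := h1 i; lia.
pose T : 'M[R]_(n, #|sg|) := \matrix_(l, a) h (enum_val a) 0 l.
have ker0 : (direction pos (cell v sg) :&: kermx T)%MS = 0.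
  apply/eqP/rowV0P => x; rewrite sub_capmx => /andP[xD /sub_kermxP xT].
  have hsg c : c \in sg -> dotmul (h c) x = 0.
    move=> csg; have := congr1 (fun M : 'rV[R]_(#|sg|) => M 0 (enum_rank_in csg c)) xT.
    rewrite !mxE dotmulE => {2}<-; apply: eq_bigr => l _.
    by rewrite [in RHS]mxE enum_rankK_in // mulrC.
  have rec c : dotmul (h (s c)) x = dotmul (h c) x + x 0 c.
    have [b hb] := dh (s c); have [b' hb'] := dh c.
    have := @direction_dot _ _ _ pos (cell v sg) (h (s c) - h c - e c) (b - b' - (m c)%:R) x.
    rewrite !dotmulBl de => H; apply/eqP; rewrite -subr_eq0 opprD addrA; apply/eqP.
    apply: H xD => u; rewrite mem_cell => /in_cellP[du _ _ _].
    rewrite !dotmulBl de hb hb' mxE.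
    have := congr1 (fun N => N%:R : R) (profile_rec c du); rewrite !natrD.
    by lra.
  have h0 : forall c, dotmul (h c) x = 0.
    apply: (cyclic_ind_back (i := i)) => [|c hc].
      rewrite /dotmul (_ : h i = 0) ?mul0mx ?mxE //.
      by apply/rowP => l; rewrite !mxE subrr.
    case: (boolP (c \in sg)) => [/hsg //|csg].
    case: (posnP (v c)) => vc.
      have /= := @direction_dot _ _ _ pos (cell v sg) (e c) 0 x.
      rewrite de => H; move: hc; rewrite rec H ?addr0 // => u.
      by rewrite mem_cell => /in_cellP[_ _ h2 _]; rewrite de mxE h2.
    have [b hb] := dh c.
    apply: (direction_dot (pos := pos) (b := (K v c)%:R + b) _ xD) => u.
    rewrite mem_cell => hu; have [_ _ _ h3] := in_cellP _ _ _ _ hu.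
    by rewrite hb (in0 u hu) subr0 h3.
  apply/rowP => c; rewrite [RHS]mxE; have := rec c.
  by rewrite !h0 add0r.
have := mxrank_mul_ker (direction pos (cell v sg)) T.
rewrite /dimf ker0 mxrank0 addn0 => <-; exact: rank_leq_col.
Qed.

Lemma cell_dim v sg : mdeg v = d -> sg \subset adm v -> dimf pos (cell v sg) = #|sg|.
Proof. by move=> dv a; apply/eqP; rewrite eqn_leq cell_dim_le // cell_dim_ge. Qed.

End CellGeometry.

(** * Boxes in terms of words *)

Section Words.
Variable n' : nat.
Local Notation n := n'.+1.
Local Notation s := (@ordS n).
Implicit Types (i j c : 'I_n) (t w : seq 'I_n).

(** The position of j in the order Q_i, as in the definition of [Qle]. *)
Definition rank i j : nat := ((j + n - i) %% n)%N.

Lemma rankE i j : rank i j = if (i <= j)%N then (j - i)%N else (j + n - i)%N.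
Proof.
rewrite /rank; case: leqP => h.
  by rewrite addnC -addnBA // addnC modnDr modn_small // (leq_ltn_trans (leq_subr _ _)).
by rewrite modn_small //; have := ltn_ord i; lia.
Qed.

Lemma rank_lt i j : (rank i j < n)%N. Proof. by rewrite ltn_mod. Qed.

Lemma rank_self i : rank i i = 0%N. Proof. by rewrite rankE leqnn subnn. Qed.

Lemma rank_inj i : injective (rank i).
Proof.
move=> a b; rewrite !rankE => h; apply: val_inj => /=; move: h.
have := ltn_ord a; have := ltn_ord b; have := ltn_ord i.
by case: (leqP i a); case: (leqP i b); lia.
Qed.

Lemma rank_ordS i j : s j != i -> rank i (s j) = (rank i j).+1.
Proof.
rewrite !rankE -val_eqE /=; have := ltn_ord i.
case: (ltnP j.+1 n) => h.
  by rewrite modn_small //; case: (leqP i j); case: (leqP i j.+1); lia.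
have e : j.+1 = n by have := ltn_ord j; lia.
by rewrite e modnn; case: (leqP i j); case: (leqP i 0); lia.
Qed.

Lemma rank_last i j : s j = i -> rank i j = n'.
Proof.
move=> e; rewrite rankE; have /= <- := congr1 val e.
case: (ltnP j.+1 n) => h; first by rewrite modn_small // ltnn; lia.
have e' : j.+1 = n by have := ltn_ord j; lia.
by rewrite e' modnn /= subn0; case: e'.
Qed.

Lemma cyclic_intervalE i a b c : (rank i a <= rank i b)%N ->
  cyclic_interval a b c = (rank i a <= rank i c <= rank i b)%N.
Proof.
rewrite /cyclic_interval !rankE.
have := ltn_ord a; have := ltn_ord b; have := ltn_ord i; have := ltn_ord c.
by case: (leqP i a); case: (leqP i b); case: (leqP i c); case: (leqP a b); lia.
Qed.

Definition word_mnm t : 'X_{1..n} := (\sum_(c <- t) U_(c))%MM.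

Lemma word_mnmE t j : word_mnm t j = count_mem j t.
Proof.
elim: t => [|c t IH]; first by rewrite /word_mnm big_nil mnm0E.
by rewrite /word_mnm big_cons mnmDE -/(word_mnm t) IH mnm1E.
Qed.

Lemma word_mnm_sum t (P : pred 'I_n) : (\sum_(j | P j) word_mnm t j)%N = count P t.
Proof.
elim: t => [|c t IH]; first by rewrite big1 // => j _; rewrite word_mnmE.
have e j : word_mnm (c :: t) j = ((c == j) + word_mnm t j)%N.
  by rewrite /word_mnm big_cons mnmDE mnm1E.
rewrite (eq_bigr _ (fun j _ => e j)) big_split /= IH; congr addn.
rewrite big_mkcond (bigD1 c) //= eqxx big1 ?addn0; first by case: (P c).
by move=> j /negPf jc; rewrite eq_sym jc if_same.
Qed.

Lemma mdeg_word_mnm t : mdeg (word_mnm t) = size t.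
Proof. by rewrite mdegE (word_mnm_sum t xpredT) count_predT. Qed.

Lemma word_mnm_Qword i (f : 'X_{1..n}) : word_mnm (Qword i f) = f.
Proof.
apply/mnmP => j; rewrite word_mnmE /Qword (permP (permEl (perm_sort _ _))).
rewrite count_flatten -map_comp sumnE big_map big_enum /= (bigD1 j) //=.
rewrite count_nseq /= eqxx mul1n big1 ?addn0 // => l /negPf lj.
by rewrite /= count_nseq /= lj mul0n.
Qed.

Lemma size_Qword i (f : 'X_{1..n}) : size (Qword i f) = mdeg f.
Proof. by rewrite -mdeg_word_mnm word_mnm_Qword. Qed.

Lemma Qword_sorted i (f : 'X_{1..n}) : sorted leq (map (rank i) (Qword i f)).
Proof. by rewrite sorted_map; apply: sort_sorted => a b; apply: leq_total. Qed.

Lemma sorted_nth_count (r : seq nat) x l : sorted leq r -> (l < size r)%N ->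
  (nth 0%N r l < x)%N = (l < count (fun y => y < x)%N r)%N.
Proof.
elim: r l => // a r IH l sr; have sr' := path_sorted sr.
have ge : {in r, forall y, (a <= y)%N}.
  by apply/allP; apply: order_path_min sr; apply: leq_trans.
case: (ltnP a x) => ax.
  by case: l => [|l] /= lr; rewrite ax ?add1n ?IH.
move=> lr; have -> : count (fun y => y < x)%N (a :: r) = 0%N.
  apply/eqP; rewrite -leqn0 leqNgt -has_count /= negb_or -leqNgt ax; apply/hasPn => y yr.
  by rewrite -leqNgt (leq_trans ax) ?ge.
apply/negbTE; rewrite -leqNgt; case: l lr => [|l] //= lr.
by apply: leq_trans ax _; apply/ge/mem_nth.
Qed.

Lemma count_pointwise (r r' : seq nat) x : size r = size r' ->
  (forall l, (l < size r)%N -> (nth 0 r l <= nth 0 r' l)%N) ->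
  (count (fun y => y < x) r' <= count (fun y => y < x) r)%N.
Proof.
elim: r r' => [|a r IH] [|a' r'] //= [es] h.
apply: leq_add; last by apply: IH => // l lr; apply: (h l.+1).
have := h 0%N isT; rewrite /=; case: (ltnP a' x) => //= lt le.
by rewrite (leq_ltn_trans le lt).
Qed.

Lemma box_vertexP i (f : 'X_{1..n}) (t : (mdeg f).-tuple 'I_n) :
  reflect (forall l, (l < mdeg f)%N ->
    (nth 0%N (0%N :: map (rank i) (Qword i f)) l <= nth 0%N (map (rank i) t) l
       <= nth 0%N (map (rank i) (Qword i f)) l)%N)
  (@box_vertex n i f t).
Proof.
rewrite /box_vertex all2E; set w := Qword i f; have sw : size w = mdeg f by apply: size_Qword.
have sz : size (zip (i :: w) w) = mdeg f by rewrite size_zip /= sw (minn_idPr _).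
rewrite sz size_tuple eqxx /=.
have sz2 : size (zip (zip (i :: w) w) t) = mdeg f by rewrite size_zip sz size_tuple minnn.
have step l : (l < mdeg f)%N ->
    (fun p => cyclic_interval p.1.1 p.1.2 p.2) (nth ((i, i), i) (zip (zip (i :: w) w) t) l)
    = (nth 0%N (0%N :: map (rank i) w) l <= nth 0%N (map (rank i) t) l
       <= nth 0%N (map (rank i) w) l)%N.
  move=> lt; rewrite nth_zip ?sz ?size_tuple //=.
  have -> : nth (i, i) (zip (i :: w) w) l = (nth i (i :: w) l, nth i w l).
    by rewrite nth_zip_cond sz lt.
  have e0 : nth 0%N (0%N :: map (rank i) w) l = rank i (nth i (i :: w) l).
    by case: l lt => [|l] lt /=; rewrite ?rank_self // (nth_map i) // sw ltnW.
  rewrite e0 !(nth_map i) ?size_tuple ?sw //=; apply: cyclic_intervalE.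
  rewrite -e0 -(nth_map i 0%N) ?sw //; case: l lt {e0} => [|l] lt //=.
  apply: (sorted_leq_nth leq_trans leqnn 0%N (Qword_sorted i f));
    rewrite ?inE ?size_map ?sw //.
  exact: ltnW.
apply: (iffP (all_nthP ((i, i), i))) => h l lt.
  by rewrite -step //; apply: h; rewrite sz2.
by rewrite sz2 in lt; have := step l lt; rewrite /= => ->; apply: h.
Qed.

Definition prefix_sum i (u : 'X_{1..n}) c : nat :=
  (\sum_(j | (rank i j < rank i c)%N) u j)%N.

Lemma prefix_sum_word i t c : prefix_sum i (word_mnm t) c
  = count (fun y => y < rank i c)%N (map (rank i) t).
Proof. by rewrite /prefix_sum word_mnm_sum count_map. Qed.

(** As the intervals of the box overlap at most in their end points, the vertices
    are the monomials whose sorted words interlace with that of f; counting the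
    letters in front of c turns this into a condition on partial sums. *)
Lemma mem_box i (f u : 'X_{1..n}) : reflect
  (mdeg u = mdeg f /\
   forall c, (prefix_sum i f c <= prefix_sum i u c <= (prefix_sum i f c).+1)%N)
  (u \in box i f).
Proof.
set W := map (rank i) (Qword i f).
have sW : size W = mdeg f by rewrite size_map size_Qword.
have pf c : prefix_sum i f c = count (fun y => y < rank i c)%N W.
  by rewrite -{1}(word_mnm_Qword i f) prefix_sum_word.
apply: (iffP idP) => [/imfsetP[t /= ht ->]|[du h]].
  rewrite -/(word_mnm (tval t)) mdeg_word_mnm size_tuple; split=> // c.
  rewrite pf prefix_sum_word; move/box_vertexP: ht; rewrite -/W => ht.
  have sT : size (map (rank i) t) = mdeg f by rewrite size_map size_tuple.
  apply/andP; split.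
    by apply: count_pointwise => [|l]; rewrite ?sT ?sW // => /ht/andP[].
  apply: (@leq_trans (count (fun y => y < rank i c)%N (take (mdeg f) (0%N :: W)))).
    apply: count_pointwise => [|l]; first by rewrite size_take /= sW ltnSn.
    by rewrite size_take /= sW ltnSn => lt; rewrite nth_take //; case/andP: (ht l lt).
  have le : (count (fun y => y < rank i c) (take (mdeg f) (0%N :: W))
              <= count (fun y => y < rank i c) (0%N :: W))%N.
    by rewrite -[X in (_ <= count _ X)%N](cat_take_drop (mdeg f)) count_cat leq_addr.
  by apply: leq_trans le _; rewrite /= -[X in (_ <= X)%N]add1n leq_add2r leq_b1.
have st : size (Qword i u) == mdeg f by rewrite size_Qword du.
apply/imfsetP; exists (Tuple st); last by rewrite -[RHS]/(word_mnm (Qword i u)) word_mnm_Qword.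
apply/box_vertexP; rewrite -/W /=; set T := map (rank i) (Qword i u).
have sT : size T = mdeg f by rewrite size_map size_Qword.
have pu c : prefix_sum i u c = count (fun y => y < rank i c)%N T.
  by rewrite -{1}(word_mnm_Qword i u) prefix_sum_word.
have Wn := sorted_nth_count _ (Qword_sorted i f); rewrite -/W sW in Wn.
have Tn := sorted_nth_count _ (Qword_sorted i u); rewrite -/T sT in Tn.
have isrank (g : 'X_{1..n}) l : mdeg g = mdeg f -> (l < mdeg f)%N ->
    exists c, nth 0%N (map (rank i) (Qword i g)) l = rank i c.
  by move=> dg lt; exists (nth i (Qword i g) l); rewrite (nth_map i) ?size_Qword ?dg.
move=> l lt; apply/andP; split.
  case: l lt => [|l] lt //=; rewrite leqNgt; apply/negP.
  have [c ec] := isrank f l erefl (ltnW lt).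
  rewrite -/W in ec; rewrite ec Tn //; have /andP[_] := h c; rewrite pf pu => le lt2.
  have : (l < count (fun y => y < rank i c)%N W)%N by have := leq_trans lt2 le.
  by rewrite -Wn ?ec ?ltnn // ltnW.
rewrite leqNgt; apply/negP.
have [c ec] := isrank u l du lt.
rewrite -/T in ec; rewrite ec Wn //; have /andP[+ _] := h c; rewrite pf pu => le lt2.
have : (l < count (fun y => y < rank i c)%N T)%N by apply: leq_trans lt2 le.
by rewrite -Tn ?ec ?ltnn.
Qed.

End Words.

(** * Boxes in terms of profiles *)

Section Boxes.
Variables (n' : nat).
Local Notation n := n'.+1.
Local Notation s := (@ordS n).
Variable m : 'X_{1..n}.
Local Notation d := (mdeg m).
Local Notation K := (profile m).
Local Notation adm := (adm m).
Local Notation cell := (cell m).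
Implicit Types (u v f : 'X_{1..n}) (c i j : 'I_n) (sg : {set 'I_n}).

Lemma prefix_sum_self i u : prefix_sum i u i = 0%N.
Proof. by rewrite /prefix_sum big_pred0 // => j; rewrite rank_self. Qed.

Lemma prefix_sum_ordS i u c : s c != i ->
  prefix_sum i u (s c) = (prefix_sum i u c + u c)%N.
Proof.
move=> ne; rewrite /prefix_sum rank_ordS // (bigD1 c) //= addnC; congr addn.
apply: eq_bigl => j; rewrite ltnS ltn_neqAle andbC; congr andb.
by rewrite (inj_eq (@rank_inj _ i)).
Qed.

Lemma prefix_sum_profile i u c : mdeg u = d ->
  (K u c + prefix_sum i m c = K u i + prefix_sum i u c)%N.
Proof.
move=> du; move: c; apply: (cyclic_ind (i := i)) => [|c IH]; first by rewrite !prefix_sum_self.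
case: (eqVneq (s c) i) => [->|ne]; first by rewrite !prefix_sum_self.
by rewrite !prefix_sum_ordS //; have := profile_rec c du; lia.
Qed.

(** In terms of profiles, a box is a unit cube in the face K u i = 0 of the
    boundary of the orthant, cut by the conditions that exponents are
    nonnegative. *)
Lemma mem_box_profile i f u : mdeg f = d -> K f i = 0%N -> reflect
  [/\ mdeg u = d, K u i = 0%N & forall c, (K f c <= K u c <= (K f c).+1)%N]
  (u \in box i f).
Proof.
move=> df f0; apply: (iffP (mem_box i f u)); rewrite df => -[du].
  have pf c := prefix_sum_profile i c df; have pu c := prefix_sum_profile i c du.
  move=> h.
  have h2 c : (K f c + K u i <= K u c <= K f c + K u i + 1)%N.
    by have := h c; have := pf c; have := pu c; lia.
  (* The bounds hold up to the constant K u i; a zero of K u shows that it is 0. *)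
  have [j hj] := profile_zero m u; have u0 : K u i = 0%N by have := h2 j; lia.
  by split=> // c; have := h2 c; lia.
move=> u0 h; split=> // c; have := h c.
by have := prefix_sum_profile i c df; have := prefix_sum_profile i c du; lia.
Qed.

Lemma profile_self c : K m c = 0%N.
Proof. by apply: (@profile_uniq _ m m (fun=> 0%N)) => //; exists ord0. Qed.

(** The monomial f itself has the smallest profile in the box.  The largest
    one arises when each letter of f moves back to its predecessor, and the first
    one to i; as a monomial this moves the last letter L of f to i.  The
    directions are the positions after i up to L. *)
Lemma box_is_cell i f : mdeg f = d -> (0 < d)%N -> K f i = 0%N ->
  exists v sg, [/\ mdeg v = d, sg \subset adm v & box i f = cell v sg].
Proof.
move=> df d0 f0.
have [l0 fl0] : exists l, (0 < f l)%N.
  apply/existsP; apply: contraLR d0 => /existsPn h; rewrite -df mdegE big1 // => l _.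
  by apply/eqP; have := h l; rewrite -eqn0Ngt.
case: (@arg_maxnP _ l0 (fun l => 0 < f l)%N (rank i) fl0) => L fL max.
have fz j : (rank i L < rank i j)%N -> f j = 0%N.
  by move=> lt; apply/eqP; rewrite -leqn0 leqNgt; apply: contraL lt => /max h; rewrite -leqNgt.
pose x c : nat := (0 < rank i c <= rank i L)%N.
pose v := of_profile m (fun c => (K f c + x c)%N).
have xi : x i = 0%N by rewrite /x rank_self.
have xS c : (x (s c) + (c == L) = x c + (c == i))%N.
  have ci : (c == i) = (rank i c == 0%N).
    by rewrite -(rank_self i) (inj_eq (@rank_inj _ i)).
  have cL : (c == L) = (rank i c == rank i L) by rewrite (inj_eq (@rank_inj _ i)).
  rewrite ci cL /x; case: (eqVneq (s c) i) => [e|ne]; last by rewrite rank_ordS //; lia.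
  have := rank_lt i L; have := rank_last e; rewrite e rank_self.
  lia.
have [||dv ev Kv] := @of_profileP _ m (fun c => (K f c + x c)%N).
- move=> c; have := profile_rec c df; have := xS c.
  by case: (eqVneq c L) => [->|_]; lia.
- by exists i; rewrite f0 xi.
rewrite -/v /= in dv ev Kv.
have vc c : (v c + (c == L) = f c + (c == i))%N.
  by have := ev c; have := xS c; have := profile_rec c df; lia.
pose sg := [set c | (0 < rank i c <= rank i L)%N].
have sgx c : (c \in sg : nat) = x c by rewrite inE.
exists v, sg; split=> //.
  by apply/subsetP => c; rewrite !inE Kv /x => ->; rewrite addn1.
have late c : c \notin sg -> c != i -> (rank i L < rank i c)%N.
  rewrite inE; have := inj_eq (@rank_inj _ i) c i; rewrite rank_self => <-.
  by lia.
have v0 c : c \notin sg -> c != i -> v c = 0%N.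
  move=> csg ci; have lt := late c csg ci; have := vc c; rewrite fz // (negPf ci).
  lia.
have vi : (0 < v i)%N.
  have := vc i; rewrite eqxx; case: (eqVneq i L) => [e|_]; last lia.
  by have := fL; rewrite -e; lia.
apply/fsetP => u; rewrite mem_cell; apply/(mem_box_profile u df f0)/in_cellP.
  move=> [du u0 h].
  have Klate c : c \notin sg -> K u c = K f c /\ (c != i -> u c = 0%N).
    move=> csg; case: (eqVneq c i) => [->|ci]; first by rewrite u0 f0.
    have lt := late c csg ci.
    have full (g : 'X_{1..n}) : (prefix_sum i g c + g c <= mdeg g)%N.
      rewrite mdegE (bigID (fun j => rank i j < rank i c)%N) /= leq_add2l.
      by rewrite (bigD1 c) ?ltnn //= leq_addr.
    have ff : prefix_sum i f c = mdeg f.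
      rewrite mdegE (bigID (fun j => rank i j < rank i c)%N) /= [X in (_ + X)%N]big1 ?addn0 //.
      move=> j; rewrite -leqNgt => le; apply: fz; exact: leq_trans lt le.
    have := full u; have := prefix_sum_profile i c df; have := prefix_sum_profile i c du.
    by have := h c; rewrite f0 u0 ff df du; lia.
  split=> // c; rewrite ?Kv -?sgx.
  - case: (boolP (c \in sg)) => [_|csg]; first by have := h c; lia.
    by have [-> _] := Klate c csg; lia.
  - move=> csg; case: (eqVneq c i) => [->|ci _]; first by lia.
    by have [_] := Klate c csg; apply.
  move=> csg _; rewrite (negPf csg) addn0; exact: (Klate c csg).1.
move=> [du h1 h2 h3].
have u0 : K u i = 0%N by have := h1 i; rewrite Kv f0 xi; lia.
have dl c : c \notin sg -> K u c = K v c.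
  suff : c \notin sg -> K u c = K v c by [].
  move: c; apply: (cyclic_ind_back (i := i)) => [_|c IH csg].
    by rewrite u0 Kv f0 xi.
  case: (eqVneq c i) => [->|ci]; first by rewrite u0 Kv f0 xi.
  have vc0 := v0 c csg ci; have uc0 := h2 c csg vc0.
  have : K u (s c) = K v (s c).
    apply: IH; rewrite inE; case: (eqVneq (s c) i) => [->|ne]; first by rewrite rank_self.
    by have := late c csg ci; rewrite rank_ordS //; lia.
  by have := profile_rec c du; have := profile_rec c dv; rewrite vc0 uc0; lia.
split=> // c; have := h1 c; have := dl c; rewrite Kv -sgx.
by case: (c \in sg) => [_|/(_ isT)]; lia.
Qed.

(** Lowering the profile of v by 1 wherever it is positive gives again a profile
    of a monomial. *)
Lemma cell_in_box v sg : mdeg v = d ->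
  exists i f, [/\ mdeg f = d, K f i = 0%N & cell v sg `<=` box i f].
Proof.
move=> dv; have [i hi] := profile_zero m v.
have [||df ef Kf] := @of_profileP _ m (fun c => (K v c).-1).
- by move=> c; have := profile_rec c dv; lia.
- by exists i; rewrite hi.
have f0 : K (of_profile m (fun c => (K v c).-1)) i = 0%N by rewrite Kf hi.
exists i, (of_profile m (fun c => (K v c).-1)); split=> //.
apply/fsubsetP => u; rewrite mem_cell => /in_cellP[du h1 _ _].
apply/(mem_box_profile u df f0); split=> // [|c]; first by have := h1 i; lia.
by rewrite Kf; have := h1 c; lia.
Qed.

End Boxes.

(** * Monomial ideals and minimal generators *)

Section MonomialIdeals.
Variables (k : fieldType) (n : nat).
Local Notation S := {mpoly k[n]}.
Implicit Types (P : 'X_{1..n} -> Prop) (p q : S).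

Lemma ideal_gen_mem (G : S -> Prop) a p : G p -> ideal_gen G (a * p).
Proof.
move=> Gp; exists [:: (a, p)]; split; last by rewrite big_seq1.
by move=> q; rewrite inE => /eqP ->.
Qed.

Lemma ideal_gen0 (G : S -> Prop) : ideal_gen G 0.
Proof. by exists [::]; rewrite big_nil. Qed.

Lemma ideal_genD (G : S -> Prop) p q :
  ideal_gen G p -> ideal_gen G q -> ideal_gen G (p + q).
Proof.
move=> [r [hr ->]] [r' [hr' ->]]; exists (r ++ r'); split; last by rewrite big_cat.
by move=> x; rewrite mem_cat => /orP[/hr|/hr'].
Qed.

Lemma ideal_gen_sum (G : S -> Prop) (I : eqType) (r : seq I) (F : I -> S) :
  (forall x, x \in r -> ideal_gen G (F x)) -> ideal_gen G (\sum_(x <- r) F x).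
Proof.
move=> h; rewrite big_seq; apply: (big_ind (ideal_gen G)) => //.
  exact: ideal_gen0.
exact: ideal_genD.
Qed.

Lemma ideal_gen_mul (G : S -> Prop) a p : ideal_gen G p -> ideal_gen G (a * p).
Proof.
move=> [r [hr ->]]; rewrite mulr_sumr; apply: ideal_gen_sum => x /hr Gx.
by rewrite mulrA; apply: ideal_gen_mem.
Qed.

Lemma ideal_gen_sub (G G' : S -> Prop) : (forall p, G p -> ideal_gen G' p) ->
  forall p, ideal_gen G p -> ideal_gen G' p.
Proof.
move=> h p [r [hr ->]]; apply: ideal_gen_sum => x /hr/h; exact: ideal_gen_mul.
Qed.

Lemma mono_idealX P f : mono_ideal P ('X_[f] : S) <-> exists2 g, P g & (g <= f)%MM.
Proof.
split=> [[r [hr e]]|[g Pg gf]]; last first.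
  by rewrite -(submK gf) mpolyXD; apply: ideal_gen_mem; exists g.
have : (\sum_(q <- r) q.1 * q.2)@_f != 0 by rewrite -e mcoeffX eqxx oner_eq0.
rewrite raddf_sum /= => nz.
have [q qr] : exists2 q, q \in r & (q.1 * q.2)@_f != 0.
  apply/hasP; apply: contraNT nz => /hasPn h; rewrite big_seq big1 // => q /h.
  by rewrite negbK => /eqP.
have [g Pg ->] := hr q qr => /mcoeff_mulX_neq0[a -> _].
by exists g => //; apply: lem_addl.
Qed.

Lemma mono_ideal_gen P f : P f -> mono_ideal P ('X_[f] : S).
Proof. by move=> Pf; apply/mono_idealX; exists f => //; apply: lepm_refl. Qed.

Lemma mono_ideal_sub P P' : (forall f, P f -> mono_ideal P' ('X_[f] : S)) ->
  forall p, mono_ideal P p -> mono_ideal P' p.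
Proof. by move=> h; apply: ideal_gen_sub => p [f /h ? ->]. Qed.

Lemma mdeg_lem_eq (f g : 'X_{1..n}) : (g <= f)%MM -> mdeg g = mdeg f -> g = f.
Proof.
move=> gf e; rewrite -(submK gf); have : mdeg (f - g)%MM == 0%N.
  by rewrite -(eqn_add2r (mdeg g)) -mdegD submK // e.
by rewrite mdeg_eq0 => /eqP ->; rewrite add0m.
Qed.

(** Between monomials of the same degree divisibility is equality, so every
    monomial generating set contains A. *)
Lemma min_gen_equigenerated (A : {fset 'X_{1..n}}) d (B : S -> Prop) f :
  (forall g, g \in A -> mdeg g = d) -> mono_generates A B ->
  (min_gen B f <-> f \in A).
Proof.
move=> hA gA; split=> [[A' [gA' minA' fA']]|fA]; last first.
  exists A; split=> // A'' sub gA''; apply/eqP; rewrite eqEfsubset sub /=.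
  apply/fsubsetP => g gA1; have : B 'X_[g] by apply/gA; apply: mono_ideal_gen.
  move/gA'' => /mono_idealX[g' g'A le]; rewrite -(mdeg_lem_eq le) //.
  by rewrite !hA // (fsubsetP sub).
have : B 'X_[f] by apply/gA'; apply: mono_ideal_gen.
move/gA => /mono_idealX[p pA pf].
have : B 'X_[p] by apply/gA; apply: mono_ideal_gen.
move/gA' => /mono_idealX[a aA' ap].
have af : (a <= f)%MM := lepm_trans ap pf.
have ea : a = f.
  apply/eqP; apply: contraT => ne.
  have E : A' `\ f = A'.
    apply: minA'; first exact: fsubD1set.
    move=> q; rewrite gA'; split; apply: mono_ideal_sub => g gA2.
      case: (eqVneq g f) => [->|gf].
        by apply/mono_idealX; exists a; rewrite // !inE ne aA'.
      by apply: mono_ideal_gen; rewrite !inE gf gA2.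
    by apply: mono_ideal_gen; move: gA2; rewrite !inE => /andP[].
  by move: fA'; rewrite -E !inE eqxx.
suff -> : f = p by [].
apply/mnmP => j; apply/eqP; rewrite eqn_leq; move/mnm_lepP: pf => ->.
by rewrite -ea; move/mnm_lepP: ap => ->.
Qed.

Lemma ideal_vars_var j : ideal_vars k n ('X_j : S).
Proof. by rewrite -['X_j]mul1r; apply: ideal_gen_mem; exists j. Qed.

Lemma prod_vars (r : seq S) : (forall x, x \in r -> ideal_vars k n x) ->
  mono_ideal (fun f => mdeg f = size r) (\prod_(x <- r) x).
Proof.
elim: r => [|x r IH] h.
  rewrite big_nil -[1]mpolyX0; apply: mono_ideal_gen; exact: mdeg0.
rewrite big_cons; have [t [ht ->]] := h x (mem_head _ _).
rewrite mulr_suml; apply: ideal_gen_sum => q /ht[j ->].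
rewrite -mulrA; apply: ideal_gen_mul.
have [t' [ht' ->]] : mono_ideal (fun f => mdeg f = size r) (\prod_(x <- r) x).
  by apply: IH => y yr; apply: h; rewrite inE yr orbT.
rewrite mulr_sumr; apply: ideal_gen_sum => q' /ht'[g dg ->].
rewrite mulrCA -mpolyXD; apply: ideal_gen_mul; apply: mono_ideal_gen.
by rewrite mdegD mdeg1 dg.
Qed.

Lemma ideal_pow_vars d q :
  ideal_pow (ideal_vars k n) d q <-> mono_ideal (fun f => mdeg f = d) q.
Proof.
split; apply: ideal_gen_sub => p.
  move=> [t [ht ->]]; rewrite -(big_tuple _ _ t xpredT id) -{1}(size_tuple t).
  by apply: prod_vars => x /tnthP[j ->].
move=> [f df ->]; rewrite -['X_[f]]mul1r; apply: ideal_gen_mem.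
have [r sr er] : exists2 r : seq 'I_n, size r = d & 'X_[f] = \prod_(j <- r) 'X_j :> S.
  exists (flatten [seq nseq (f j) j | j <- enum 'I_n]).
    rewrite size_flatten /shape -map_comp sumnE big_map big_enum /= -df mdegE.
    by apply: eq_bigr => j _; rewrite /= size_nseq.
  rewrite big_flatten big_map big_enum /= mpolyXE_id; apply: eq_bigr => j _.
  by rewrite big_nseq; elim: (f j) => [|a IH] //=; rewrite exprS IH.
have st : size [seq 'X_j : S | j <- r] == d by rewrite size_map sr.
exists (Tuple st); split; last by rewrite er -(big_tuple _ _ (Tuple st) xpredT id) /= big_map.
by move=> j; have /mapP[l _ ->] := mem_tnth j (Tuple st); apply: ideal_vars_var.
Qed.

End MonomialIdeals.

(** * Principal Borel ideals *)

Section BorelIdeals.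
Variables (k : fieldType) (n' : nat).
Local Notation n := n'.+1.
Local Notation s := (@ordS n).
Local Notation S := {mpoly k[n]}.
Variable m : 'X_{1..n}.
Local Notation d := (mdeg m).
Local Notation K := (profile m).
Implicit Types (u v f g : 'X_{1..n}) (a b c i j : 'I_n).

(** The move raises the profile by 1 on the positions after a up to b, which
    do not include i. *)
Lemma borel_move i a b f : mdeg f = d -> K f i = 0%N -> Qlt i a b -> (0 < f b)%N ->
  mdeg (f - U_(b) + U_(a))%MM = d /\ K (f - U_(b) + U_(a))%MM i = 0%N.
Proof.
move=> df f0; rewrite /Qlt -/(rank i a) -/(rank i b) => ab fb.
have bU : (U_(b) <= f)%MM.
  by apply/mnm_lepP => j; rewrite mnm1E; case: eqP => [<-|].
have dg : mdeg (f - U_(b) + U_(a))%MM = d.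
  have := congr1 mdeg (submK bU); rewrite !mdegD !mdeg1 df => <-.
  by rewrite addn1.
split=> //; pose x c : nat := (rank i a < rank i c <= rank i b)%N.
have xS c : (x (s c) + (c == b) = x c + (c == a))%N.
  have ca : (c == a) = (rank i c == rank i a) by rewrite (inj_eq (@rank_inj _ i)).
  have cb : (c == b) = (rank i c == rank i b) by rewrite (inj_eq (@rank_inj _ i)).
  rewrite ca cb /x; case: (eqVneq (s c) i) => [e|ne]; last by rewrite rank_ordS //; lia.
  by have := rank_lt i b; have := rank_last e; rewrite e rank_self; lia.
rewrite (@profile_uniq _ _ _ (fun c => K f c + x c)%N) //.
- by rewrite f0 /x rank_self ltn0.
- move=> c; rewrite mnmDE mnmBE !mnm1E [b == c]eq_sym [a == c]eq_sym.
  have := xS c; have := profile_rec c df; have := fb.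
  by case: (eqVneq c b) => [->|_]; lia.
by exists i; rewrite f0 /x rank_self ltn0.
Qed.

Definition borel_gens i f : Prop := mdeg f = d /\ K f i = 0%N.

Lemma borel_gens_Q_Borel i : Q_Borel (k := k) i (mono_ideal (borel_gens i)).
Proof.
split; first by exists (borel_gens i).
move=> f b a /mono_idealX[g [dg g0] gf] fb ab; apply/mono_idealX.
case: (posnP (g b)) => gb.
  exists g; first by split.
  apply/mnm_lepP => j; rewrite mnmDE mnmBE !mnm1E; move/mnm_lepP/(_ j): gf.
  by case: (eqVneq b j) => [<-|_]; rewrite ?gb //; lia.
exists (g - U_(b) + U_(a))%MM; first exact: borel_move.
apply/mnm_lepP => j; rewrite !mnmDE !mnmBE !mnm1E leq_add2r leq_sub2r //.
by move/mnm_lepP: gf.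
Qed.

(** Descend to m, the only monomial of degree d with profile 0: if the profile of
    f is not 0, then it is positive after some letter of f, and moving this
    letter one step forward lowers it. *)
Lemma borel_gens_sub i B f : Q_Borel (k := k) i B -> B 'X_[m] ->
  borel_gens i f -> B 'X_[f].
Proof.
move=> [_ hB] Bm; elim/ltn_ind: {f}(\sum_c K f c)%N {-2}f (erefl (\sum_c K f c)%N).
move=> N IH f eN [df f0].
case: (pickP [pred a | (0 < f a) && (0 < K f (s a))]%N) => [a /andP[fa Kb]|no].
  have bi : s a != i by apply: contraTneq Kb => ->; rewrite f0.
  have [||dg eg Kg] := @of_profileP _ m (fun c => K f c - (c == s a))%N.
  - move=> c; have := profile_rec c df; rewrite (inj_eq (@ordS_inj n)).
    by case: (eqVneq c a) => [->|_]; lia.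
  - by exists i; rewrite f0.
  move: (of_profile _ _) dg eg Kg => g dg eg Kg; rewrite /= in eg Kg.
  have rk : rank i (s a) = (rank i a).+1 by apply: rank_ordS.
  have asa : a != s a by apply/eqP => /(congr1 (rank i)); lia.
  have e c : (g c + (c == a) = f c + (c == s a))%N.
    have := eg c; have := profile_rec c df; rewrite (inj_eq (@ordS_inj n)).
    case: (eqVneq c (s a)) => [->|_]; first by rewrite [s a == a]eq_sym (negPf asa); lia.
    by case: (eqVneq c a) => [->|_]; lia.
  have gs : (0 < g (s a))%N by have := e (s a); rewrite eqxx [s a == a]eq_sym (negPf asa); lia.
  have -> : f = (g - U_(s a) + U_(a))%MM.
    apply/mnmP => c; rewrite mnmDE mnmBE !mnm1E [s a == c]eq_sym [a == c]eq_sym.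
    have := e c; case: (eqVneq c (s a)) => [->|_] /=; last by rewrite addn0 subn0.
    by move: gs; case: (g (s a)) => // x _; rewrite addn1 subn1 addSn => -[<-].
  apply: hB => //; last by rewrite /Qlt -/(rank i a) -/(rank i (s a)) rk.
  apply: (IH _ _ g erefl); last by split=> //; rewrite Kg f0.
  rewrite -eN (bigD1 (s a)) //= [X in (_ < X)%N](bigD1 (s a)) //= Kg eqxx.
  rewrite (eq_bigr (fun c => K f c)) => [|c /negPf ne]; last by rewrite Kg ne subn0.
  by rewrite ltn_add2r subn1 ltn_predL.
suff -> : f = m by [].
apply: (profile_inj (m := m)) => // c; rewrite profile_self; apply/eqP.
rewrite -leqn0 leqNgt; apply/negP => Kc.
suff /(_ i) : forall j, (0 < K f j)%N by rewrite f0.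
apply: (cyclic_ind_back (i := c)) => // j Kj; have := no j; rewrite /= Kj andbT.
by have := profile_rec j df; lia.
Qed.

Lemma borel_gens_m i : borel_gens i m.
Proof. by split=> //; apply: profile_self. Qed.

Lemma principal_BorelE i q : principal_Borel k i m q <-> mono_ideal (borel_gens i) q.
Proof.
split=> [h|h B hB Bm].
  apply: h; first exact: borel_gens_Q_Borel.
  by apply: mono_ideal_gen; apply: borel_gens_m.
have [[P hP] _] := hB; apply/hP; apply: mono_ideal_sub h => f gf.
by apply/hP; apply: borel_gens_sub gf.
Qed.

Lemma min_gen_principal_Borel i f :
  min_gen (principal_Borel k i m) f <-> mdeg f = d /\ K f i = 0%N.
Proof.
pose A : {fset 'X_{1..n}} := [fset val u | u in
  [pred u : 'X_{1..n < d.+1} | (mdeg (val u) == d) && (K (val u) i == 0%N)]].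
have memA g : g \in A <-> mdeg g = d /\ K g i = 0%N.
  split=> [/imfsetP[u /= /andP[/eqP du /eqP u0] ->] //|[dg g0]].
  have lt : (mdeg g < d.+1)%N by rewrite dg.
  have gA : (mdeg g == d) && (K g i == 0%N) by rewrite dg g0 !eqxx.
  by apply/imfsetP; exists (BMultinom lt).
rewrite -memA; apply: (min_gen_equigenerated (d := d)) => [g /memA[]//|q].
rewrite principal_BorelE; by split; apply: mono_ideal_sub => g /memA gA; apply: mono_ideal_gen.
Qed.

End BorelIdeals.

(** * The union of the complexes of boxes *)

Section MonomialComplex.
Variables (R : realFieldType) (k : fieldType) (n' : nat).
Local Notation n := n'.+1.
Local Notation S := {mpoly k[n]}.
Variable m : 'X_{1..n}.
Local Notation d := (mdeg m).
Hypothesis d_gt0 : (0 < d)%N.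
Local Notation K := (profile m).
Local Notation adm := (adm m).
Local Notation cell := (cell m).
Local Notation pos := (@exponent_vector n R).
Implicit Types (u v f : 'X_{1..n}) (j : 'I_n) (sg : {set 'I_n}).

Definition valid_cell (x : 'X_{1..n < d.+1} * {set 'I_n}) : bool :=
  (mdeg (val x.1) == d) && (x.2 \subset adm (val x.1)).

Definition box_complex : {fset {fset 'X_{1..n}}} :=
  fset0 |` [fset cell (val x.1) x.2 | x in [pred x | valid_cell x]].

Lemma mem_complex F : F \in box_complex <-> F = fset0 \/
  exists v sg, [/\ mdeg v = d, sg \subset adm v & F = cell v sg].
Proof.
rewrite /box_complex !inE; split.
  case/orP => [/eqP|/imfsetP[[v sg] /= /andP[/eqP dv a] ->]]; first by left.
  by right; exists (val v), sg.
case=> [->|[v [sg [dv a ->]]]]; first by rewrite eqxx.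
apply/orP; right; have lt : (mdeg v < d.+1)%N by rewrite dv.
have hv : valid_cell (BMultinom lt, sg) by rewrite /valid_cell /= dv eqxx.
by apply/imfsetP; exists (BMultinom lt, sg).
Qed.

Lemma cell_in_complex v sg : mdeg v = d -> sg \subset adm v -> cell v sg \in box_complex.
Proof. by move=> dv a; apply/mem_complex; right; exists v, sg. Qed.

Lemma complex_boxes F : F \in box_complex <->
  exists i : 'I_n, complex_of_boxes R i (principal_Borel k i m) F.
Proof.
rewrite mem_complex.
split=> [[->|[v [sg [dv a ->]]]]|[i [f /min_gen_principal_Borel[df f0] hF]]].
- exists ord0, m; first by apply/min_gen_principal_Borel; split=> //; apply: profile_self.
  exists 0, 1; split=> [u _|]; first by rewrite /dotmul mul0mx mxE ler01.
  apply/fsetP => u; rewrite !inE /dotmul mul0mx mxE eq_sym oner_eq0 andbF //.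
- have [i [f [df f0 sub]]] := cell_in_box sg dv.
  exists i, f; first exact/min_gen_principal_Borel.
  have [v' [sg' [dv' a' e]]] := box_is_cell df d_gt0 f0.
  by rewrite e in sub *; apply: cell_is_face.
have [v [sg [dv a e]]] := box_is_cell df d_gt0 f0; rewrite e in hF.
by case: (eqVneq F fset0) => [->|F0]; [left | right; apply: cell_face hF F0].
Qed.

Lemma complex_polytopal : polytopal_complex pos box_complex.
Proof.
apply: (regular_complex (W := fun u => mdeg u = d) (h := convex_height R m)).
- move=> F /mem_complex[->|[v [sg [dv a ->]]]]; last exact: cell_lower_face.
  split=> [v|]; first by rewrite inE.
  exists 0, (-1) => v _; rewrite /dotmul mul0mx mxE add0r inE.
  have h0 : 0 <= convex_height R m v by apply: sumr_ge0 => c _; apply: sqr_ge0.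
  by split; [lra | apply/negbTE; rewrite lt_eqF //; lra].
- by move=> v dv; rewrite -(cell0 dv); apply: cell_lower_face; rewrite ?sub0set.
move=> F G /mem_complex[->|[v [sg [dv a ->]]]] hG; apply/mem_complex.
  by left; apply/eqP; rewrite -fsubset0; apply: face_fsub hG.
by case: (eqVneq G fset0) => [->|G0]; [left | right; apply: cell_face hG G0].
Qed.

Lemma mem_complex1 v : [fset v] \in box_complex <-> mdeg v = d.
Proof.
split=> [/mem_complex[/fsetP/(_ v)|[w [sg [dw a e]]]]|dv]; first by rewrite !inE eqxx.
  have : v \in cell w sg by rewrite -e inE.
  by rewrite mem_cell => /in_cellP[].
by rewrite -(cell0 dv); apply: cell_in_complex; rewrite ?sub0set.
Qed.

Lemma complex_generates q : ideal_pow (ideal_vars k n) d q <->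
  mono_ideal (fun f => exists2 v, [fset v] \in box_complex & f = id v) q.
Proof.
rewrite ideal_pow_vars; split; apply: mono_ideal_sub => f.
  by move=> df; apply: mono_ideal_gen; exists f => //; apply/mem_complex1.
by case=> v /mem_complex1 dv ->; apply: mono_ideal_gen.
Qed.

(** The top vertex and the directions of a cell given by its vertex set; well
    defined by [cell_injective]. *)
Definition decode (F : {fset 'X_{1..n}}) : 'X_{1..n} * {set 'I_n} :=
  if [pick x | valid_cell x && (cell (val x.1) x.2 == F)] is Some x
  then (val x.1, x.2) else (0%MM, set0).

Lemma decode_cell v sg : mdeg v = d -> sg \subset adm v -> decode (cell v sg) = (v, sg).
Proof.
move=> dv a; rewrite /decode; case: pickP => [[w sg'] /=|/=].
  move=> /andP[/andP[/eqP dw a'] /eqP e].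
  by have /= [-> ->] := cell_injective dw a' dv a e.
have lt : (mdeg v < d.+1)%N by rewrite dv.
by move=> /(_ (BMultinom lt, sg)); rewrite /valid_cell /= dv a !eqxx.
Qed.

Local Notation B i := (cells pos box_complex i).
Definition cell_top i (x : B i) : 'X_{1..n} := (decode (val x)).1.
Definition cell_dirs i (x : B i) : {set 'I_n} := (decode (val x)).2.

Lemma cellP i (x : B i) : [/\ mdeg (cell_top x) = d, cell_dirs x \subset adm (cell_top x),
  val x = cell (cell_top x) (cell_dirs x) & #|cell_dirs x| = i].
Proof.
have /cellsP[/mem_complex[->|[v [sg [dv a e]]]] x0 dx] := valP x; first by rewrite eqxx in x0.
by rewrite /cell_top /cell_dirs e decode_cell //=; split=> //; rewrite -dx e cell_dim.
Qed.

Lemma cell_of v sg i : mdeg v = d -> sg \subset adm v -> #|sg| = i ->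
  exists2 x : B i, cell_top x = v & cell_dirs x = sg.
Proof.
move=> dv a ei; have h : cell v sg \in B i.
  apply/cellsP; split; [exact: cell_in_complex | | by rewrite cell_dim].
  by apply/fset0Pn; exists v; rewrite mem_cell top_in_cell.
by exists [` h]; rewrite /cell_top /cell_dirs /= decode_cell.
Qed.

Lemma label_of i (x : B i) j :
  face_label id (val x) j = (cell_top x j + (j \in cell_dirs x))%N.
Proof. by have [dx a -> _] := cellP x; rewrite cell_label. Qed.

Lemma mdeg_label i (x : B i) : mdeg (face_label id (val x)) = (d + i)%N.
Proof.
have [dx _ _ ei] := cellP x; rewrite mdegE (eq_bigr _ (fun j _ => label_of x j)).
rewrite big_split /= -mdegE dx; congr addn.
by rewrite -[RHS]ei -sum1_card [in RHS]big_mkcond.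
Qed.

Lemma label_mono (F G : {fset 'X_{1..n}}) : F `<=` G ->
  (face_label id F <= face_label id G)%MM.
Proof.
move=> sub; apply/mnm_lepP => j; rewrite !face_labelE.
apply/bigmax_leqP_seq => u uF _.
apply: (leq_bigmax_seq (F := fun u : 'X_{1..n} => u j) u) => //; exact: (fsubsetP sub).
Qed.

Section Oriented.
Variable o : forall i, {fset 'X_{1..n}} -> 'M[R]_(i, n).
Hypothesis ho : orientation pos box_complex o.
Local Notation delta i := (@cell_boundary R n _ pos k n id o box_complex i).
Local Notation eps := (@cell_augment R n _ pos k n id box_complex).
Local Notation sinc := (signed_incidence pos o).

Lemma boundaryE i (x : B i.+1) (y : B i) : delta i x y =
  (sinc i (val y) (val x))%:~R *: 'X_[face_label id (val x) - face_label id (val y)].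
Proof.
by rewrite /cell_boundary /signed_incidence; case: ifP => // _; rewrite mulr0z scale0r.
Qed.

Lemma boundary_subset i (x : B i.+1) (y : B i) : delta i x y != 0 -> val y `<=` val x.
Proof. by rewrite /cell_boundary; case: ifP => //; rewrite eqxx. Qed.

Lemma boundary_tri i (x : B i.+1) (y : B i) : delta i x y != 0 ->
  (cell_top y = cell_top x /\ cell_dirs y \subset cell_dirs x) \/
  (weight m (cell_top y) < weight m (cell_top x))%N.
Proof.
move=> /boundary_subset; have [dx ax -> _] := cellP x; have [dy ay -> _] := cellP y.
exact: cell_subset.
Qed.

Lemma boundary_koszul i (x : B i.+1) (y : B i) j :
  cell_top x = cell_top y -> j \notin cell_dirs y -> cell_dirs x = j |: cell_dirs y ->
  exists2 a, a != 0 & delta i x y = a *: 'X_j.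
Proof.
move=> et jy ed; have sub : val y `<=` val x.
  have [_ _ -> _] := cellP x; have [_ _ -> _] := cellP y.
  by rewrite et ed; apply: cell_mono; apply: subsetUr.
exists (incidence pos o i (val y) (val x))%:~R.
  have := cell_incidence_neq0 complex_polytopal ho (valP x) (valP y) sub.
  rewrite /incidence; case: sgzP => // _ _; first by rewrite oner_eq0.
  by rewrite mulrN1z oppr_eq0 oner_eq0.
rewrite /cell_boundary sub; congr (_ *: 'X_[_]); apply/mnmP => l.
rewrite mnmBE !label_of et ed !inE mnm1E subnDl [j == l]eq_sym.
by case: (eqVneq l j) => [->|_] /=; rewrite ?(negPf jy) ?subnn.
Qed.

Lemma boundary_boundary i c : free_map (delta i) (free_map (delta i.+1) c) = 0.
Proof.
apply/ffunP => z; rewrite !ffunE.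
under eq_bigr do rewrite ffunE mulr_suml.
rewrite exchange_big big1 //= => x _.
under eq_bigr do rewrite -mulrA.
rewrite -mulr_sumr [X in _ * X](_ : _ = 0) ?mulr0 //.
have e (y : B i.+1) : delta i.+1 x y * delta i y z =
    (sinc i.+1 (val y) (val x) * sinc i (val z) (val y))%:~R
      *: 'X_[face_label id (val x) - face_label id (val z)].
  rewrite !boundaryE -scalerAl -scalerAr scalerA -intrM -mpolyXD.
  have [s1|n1] := boolP (val y `<=` val x); last first.
    by rewrite /signed_incidence (negPf n1) mul0r !mulr0z !scale0r.
  have [s2|n2] := boolP (val z `<=` val y); last first.
    by rewrite /signed_incidence (negPf n2) mulr0 !mulr0z !scale0r.
  congr (_ *: 'X_[_]); apply/mnmP => j; rewrite mnmDE !mnmBE.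
  by rewrite addnBA ?subnK //; apply/mnm_lepP/label_mono.
rewrite (eq_bigr _ (fun y _ => e y)) -scaler_suml -raddf_sum /=.
by rewrite (incidence_sum complex_polytopal ho (valP x) (valP z)) mulr0z scale0r.
Qed.

Lemma vertex_label (y : B 0) : face_label id (val y) = cell_top y.
Proof.
apply/mnmP => j; have [_ _ _ /eqP] := cellP y; rewrite cards_eq0 label_of => /eqP ->.
by rewrite inE addn0.
Qed.

Lemma edge_vertices v c u : mdeg v = d -> c \in adm v ->
  in_cell m v [set c] u = (u == v) || (u == flip m v c).
Proof.
move=> dv ca; have a : [set c] \subset adm v by rewrite sub1set.
have Kc : (0 < K v c)%N by rewrite inE in ca.
apply/idP/orP => [hu|[]/eqP ->]; [|exact: top_in_cell|exact/flip_in_cell/set11].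
case: (boolP (uses m v c u)) => [uc|nu]; last first.
  by left; apply/eqP; apply: cell_idle dv hu _ => j; rewrite inE => /eqP ->.
right; have lead : leading v [set c] c by move=> j _; rewrite inE => /eqP.
have lt : (K u c < K v c)%N by apply: uses_lt hu uc.
have := cell_flip u dv a (set11 c) lead; rewrite hu lt setDv -mem_cell.
by have [df _ _] := flipP dv Kc; rewrite cell0 // inE.
Qed.

Lemma edge_sum (x : B 1) : \sum_(y : B 0) sinc 0 (val y) (val x) = 0.
Proof.
have [dx ax ex /eqP/cards1P[c ec]] := cellP x.
set v := cell_top x in dx ax ex; rewrite ec in ax ex.
have ca : c \in adm v by rewrite -sub1set.
have Kc : (0 < K v c)%N by rewrite inE in ca.
have [df _ Kf] := flipP dx Kc.
have vw : v != flip m v c.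
  apply/eqP => e; have := Kf c; rewrite run_self -e; lia.
have eF : val x = [fset v; flip m v c].
  by apply/fsetP => u; rewrite ex mem_cell edge_vertices // !inE.
have vertex u : mdeg u = d -> exists2 y : B 0, val y = [fset u] & cell_top y = u.
  move=> du; have [|y ty dy] := @cell_of u set0 0 du (sub0set _); first by rewrite cards0.
  by exists y => //; have [_ _ -> _] := cellP y; rewrite ty dy cell0.
have [y1 e1 t1] := vertex v dx; have [y2 e2 t2] := vertex _ df.
have ne : y2 != y1 by apply: contra vw => /eqP e; apply/eqP; rewrite -[LHS]t1 -t2 e.
rewrite (bigD1 y1) //= (bigD1 y2) //= big1 ?addr0 => [|y /andP[n1 n2]]; last first.
  have [dy _ ey /eqP] := cellP y; rewrite cards_eq0 => /eqP e0.
  rewrite e0 cell0 // in ey; rewrite /signed_incidence; case: ifP => // /fsubsetP.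
  move=> /(_ (cell_top y)); rewrite ey eF !inE eqxx => /(_ isT)/orP[]/eqP ety.
    by case/eqP: n1; apply: val_inj; rewrite ey e1 ety.
  by case/eqP: n2; apply: val_inj; rewrite ey e2 ety.
rewrite /signed_incidence e1 e2 !fsub1set eF !inE !eqxx orbT /=.
by rewrite (edge_incidence pos o vw erefl) subrr.
Qed.

Lemma augment_boundary c : augment eps (free_map (delta 0) c) = 0.
Proof.
rewrite /augment; under eq_bigr do rewrite ffunE mulr_suml.
rewrite exchange_big big1 //= => x _; under eq_bigr do rewrite -mulrA.
rewrite -mulr_sumr [X in _ * X](_ : _ = 0) ?mulr0 //.
have e (y : B 0) : delta 0 x y * eps y = (sinc 0 (val y) (val x))%:~R
      *: 'X_[face_label id (val x)].
  rewrite boundaryE /cell_augment -scalerAl -mpolyXD.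
  have [s1|n1] := boolP (val y `<=` val x); first by rewrite submK // label_mono.
  by rewrite /signed_incidence (negPf n1) !mulr0z !scale0r.
by rewrite (eq_bigr _ (fun y _ => e y)) -scaler_suml -raddf_sum /= edge_sum mulr0z scale0r.
Qed.

Lemma augment_image q : ideal_pow (ideal_vars k n) d q <-> exists c, q = augment eps c.
Proof.
rewrite ideal_pow_vars; split=> [[r [hr ->]]|[c ->]]; last first.
  apply: ideal_gen_sum => y _; apply: ideal_gen_mul; apply: mono_ideal_gen.
  by rewrite vertex_label; have [] := cellP y.
elim: r hr => [|x r IH] hr.
  exists 0; rewrite big_nil /augment big1 // => y _; by rewrite ffunE mul0r.
have [|c ec] := IH; first by move=> y yr; apply: hr; rewrite inE yr orbT.
have [f df ef] := hr x (mem_head _ _).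
have [|y ty dy] := @cell_of f set0 0 df (sub0set _); first by rewrite cards0.
exists (c + [ffun z => if z == y then x.1 else 0]).
rewrite big_cons ec addrC /augment; under [RHS]eq_bigr do rewrite !ffunE mulrDl.
rewrite big_split; congr (_ + _); rewrite (bigD1 y) //= eqxx big1 => [|z /negPf ->].
  by rewrite addr0 ef /cell_augment vertex_label ty.
by rewrite mul0r.
Qed.

Lemma complex_resolution : minimal_free_resolution
  (@cell_boundary R n _ pos k n id o box_complex)
  (@cell_augment R n _ pos k n id box_complex) (ideal_pow (ideal_vars k n) d).
Proof.
split; last first.
  move=> i b y; rewrite ffunE; apply: ideal_gen_sum => x _; apply: ideal_gen_mul.
  rewrite boundaryE -mul_mpolyC; apply: ideal_gen_mul.
  have /forallPn[j] : ~~ (face_label id (val x) <= face_label id (val y))%MM.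
    apply/negP => le; have := submK le; move/(congr1 mdeg).
    by rewrite mdegD !mdeg_label; lia.
  rewrite -ltnNge => lt; have le : (U_(j) <= face_label id (val x) - face_label id (val y))%MM.
    apply/mnm_lepP => l; rewrite mnm1E mnmBE; case: eqP => [<-|//].
    by rewrite subn_gt0.
  by rewrite -(submK le) mpolyXD; apply: ideal_gen_mul; apply: ideal_vars_var.
apply: (koszul_filtration_resolution (top := cell_top) (dirs := cell_dirs) (adm := adm)
          (wt := weight m)).
- by move=> i x; have [] := cellP x.
- by move=> i x; have [] := cellP x.
- move=> i x y et ed; apply: val_inj.
  by have [_ _ -> _] := cellP x; have [_ _ -> _] := cellP y; rewrite et ed.
- by move=> i j x sg a ej; have [dx _ _ _] := cellP x; apply: cell_of.
- by move=> x; rewrite /cell_augment vertex_label.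
- exact: boundary_tri.
- exact: boundary_koszul.
- exact: boundary_boundary.
- exact: augment_boundary.
- move=> x y b xb yb hx hy.
  have [dx _ ex /eqP] := cellP x; have [dy _ ey /eqP] := cellP y.
  rewrite !cards_eq0 => /eqP ey0 /eqP ex0; apply: val_inj; rewrite ex ey ex0 ey0.
  suff -> : cell_top x = cell_top y; first reflexivity.
  apply: (saturated_uniq dx dy xb yb) => c Kc.
    by apply: hx; rewrite inE.
  by apply: hy; rewrite inE.
exact: augment_image.
Qed.

End Oriented.

End MonomialComplex.

Lemma min_gen_ideal_pow (k : fieldType) (n d : nat) (m : 'X_{1..n}) :
  min_gen (ideal_pow (ideal_vars k n) d) m -> mdeg m = d.
Proof.
pose A : {fset 'X_{1..n}} := [fset val u | u in
  [pred u : 'X_{1..n < d.+1} | mdeg (val u) == d]].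
have memA g : g \in A <-> mdeg g = d.
  split=> [/imfsetP[u /= /eqP du ->] //|dg].
  have lt : (mdeg g < d.+1)%N by rewrite dg.
  have gA : mdeg g == d by rewrite dg.
  by apply/imfsetP; exists (BMultinom lt).
rewrite (min_gen_equigenerated (A := A) (d := d)) => [/memA //|g /memA //|q].
rewrite ideal_pow_vars.
by split; apply: mono_ideal_sub => g /memA gA; apply: mono_ideal_gen.
Qed.

Theorem theorem5p9 (R : realFieldType) (k : fieldType) (n d : nat)
    (hd : (0 < d)%N) (m : 'X_{1..n})
    (hm : min_gen (ideal_pow (ideal_vars k n) d) m) :
  supports_minimal_free_resolution (exponent_vector R) id
    (fun F => exists i : 'I_n, complex_of_boxes R i (principal_Borel k i m) F)
    (ideal_pow (ideal_vars k n) d).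
Proof.
have dm := min_gen_ideal_pow hm; subst d.
case: n m hm hd => [m _|n' m _ hd]; first by rewrite mdegE big_ord0.
exists (box_complex m); first by move=> F; apply: complex_boxes.
split; [exact: complex_polytopal | exact: complex_generates | exact: complex_resolution].
Qed.
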